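(* Let $a,d,k\in\mathbb{N}$ and work over $\mathbb{F}=\mathbb{C}$. Then the $k$-fold map $\kappa_{a,d}^k:\Lambda^{\mathbb{C}}_{\le a}[\mathbf{x}_{kd}]\to\Lambda^{\mathbb{C}}_{\le ka}[\mathbf{y}_d]$ is injective if $a\le d$ and surjective if $a\ge d$.
   Context: $\Lambda^{\mathbb{C}}_{\le n}[\mathbf{x}_m]$ is the $\mathbb{C}$-vector space of symmetric polynomials in $m$ variables $\mathbf{x}_m=(x_1,\dots,x_m)$ with degree at most $n$ in each variable. The $k$-fold map $\kappa_{a,d}^k$ sends $f(x_1,\dots,x_{kd})$ to $f(y_1,\dots,y_1,\dots,y_d,\dots,y_d)$, where each $y_i$ is repeated $k$ times (i.e. $x_i\mapsto y_{\lceil i/k\rceil}$). *)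

(* Defs.v *)
From HB Require Import structures.
From mathcomp Require Import all_boot all_order all_algebra all_fingroup.
From mathcomp Require Import mpoly.

Set Implicit Arguments.
Unset Strict Implicit.
Unset Printing Implicit Defensive.

Import GRing.Theory.
Local Open Scope ring_scope.

Section SymBounded.
Variables (F : fieldType) (n m : nat).

Definition symle_pred : pred {mpoly F[m]} := fun p =>
  (p \is symmetric) && all (fun u : 'X_{1..m} => [forall i, u i <= n]%N) (msupp p).
Arguments symle_pred _ /.
Definition symle : qualifier 0 {mpoly F[m]} := [qualify p | symle_pred p].

Lemma symleP (p : {mpoly F[m]}) :
  reflect (p \is symmetric /\
           forall u : 'X_{1..m}, u \in msupp p -> forall i, (u i <= n)%N)
          (p \is symle).
Proof.
apply: (iffP andP) => -[sp dp]; split=> //.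
  by move=> u /(allP dp)/forallP.
by apply/allP=> u /dp H; apply/forallP.
Qed.

Lemma symle_submod_closed : submod_closed symle.
Proof.
split=> [|c p q /symleP[sp dp] /symleP[sq dq]]; apply/symleP.
  by split=> [|u]; [exact: rpred0 | rewrite msupp0].
split=> [|u /msuppD_le]; first by rewrite rpredD ?rpredZ.
by rewrite mem_cat => /orP[/msuppZ_le/dp|/dq].
Qed.

HB.instance Definition _ :=
  GRing.isSubmodClosed.Build F {mpoly F[m]} symle_pred symle_submod_closed.

(* The F-space of symmetric polynomials in m variables, of degree at most n in
   each variable. *)
Record Lambda := MkLambda { Lambda_poly :> {mpoly F[m]}; _ : Lambda_poly \is symle }.

HB.instance Definition _ := [isSub of Lambda for Lambda_poly].
HB.instance Definition _ := [Choice of Lambda by <:].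
HB.instance Definition _ := [SubChoice_isSubLmodule of Lambda by <:].

End SymBounded.

Arguments symle {F} n {m}.

Section KFold.
Variables (F : fieldType) (a d k : nat).

Lemma kfold_idx_proof (i : 'I_(k * d)) : (i %/ k < d)%N.
Proof.
case: k i => [[]//|k' i].
by rewrite ltn_divLR // [X in (_ < X)%N]mulnC; apply: ltn_ord.
Qed.

(* With indices starting at 0, ceil(i / k) becomes i %/ k. *)
Definition kfold_idx (i : 'I_(k * d)) : 'I_d := Ordinal (kfold_idx_proof i).

Definition kfold_subst (f : {mpoly F[k * d]}) : {mpoly F[d]} :=
  f \mPo [tuple 'X_(kfold_idx i) | i < k * d].

Lemma kfold_idx_card (j : 'I_d) : #|[pred i | kfold_idx i == j]| = k.
Proof.
have lt (r : 'I_k) : (j * k + r < k * d)%N.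
  rewrite mulnC; apply: leq_trans (_ : k * j.+1 <= _)%N.
    by rewrite mulnS addnC ltn_add2r.
  by rewrite leq_mul2l ltn_ord orbT.
pose f r := Ordinal (lt r).
have injf : injective f.
  by move=> r s /(congr1 val) /= /addnI /val_inj.
rewrite -[RHS]card_ord -(card_imset _ injf) -[RHS]cardsE -cardsE; apply: eq_card => i.
rewrite !inE; apply/eqP/imsetP => [ij|[r _ ->]].
  have k0 : (0 < k)%N by case: (posnP k) i {ij} => // -> [].
  exists (Ordinal (ltn_pmod i k0)) => //; apply: val_inj => /=.
  by rewrite -ij /= -divn_eq.
have k0 : (0 < k)%N by apply: leq_ltn_trans (ltn_ord r).
by apply: val_inj; rewrite /= divnMDl // divn_small ?addn0.
Qed.

Lemma kfold_subst_symle f :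
  f \is symle a -> kfold_subst f \is symle (k * a).
Proof.
case/symleP=> sf df; apply/symleP; split.
  apply: msym_comp_poly => // s.
  apply/tuple_permP.
  pose h (i : 'I_(k * d)) := (s^-1%g (kfold_idx i) * k + i %% k)%N.
  have k0 (i : 'I_(k * d)) : (0 < k)%N by case: (posnP k) i => // -> [].
  have hlt i : (h i < k * d)%N.
    rewrite mulnC -ltn_divLR ?(k0 i) // /h divnMDl ?(k0 i) //.
    by rewrite divn_small ?ltn_mod ?(k0 i) // addn0.
  pose g i := Ordinal (hlt i).
  have gE i : kfold_idx (g i) = s^-1%g (kfold_idx i).
    apply: val_inj; rewrite /= /h divnMDl ?(k0 i) //.
    by rewrite divn_small ?ltn_mod ?(k0 i) // addn0.
  have injg : injective g.
    move=> i j eq_g; have := congr1 (@kfold_idx) eq_g.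
    rewrite !gE => /perm_inj /(congr1 val) /= e1.
    have := congr1 (fun i : 'I__ => (i %% k)%N) eq_g.
    rewrite /= /h !modnMDl !modn_mod => e2.
    by apply: val_inj; rewrite /= (divn_eq i k) (divn_eq j k) e1 e2.
  exists (perm injg); congr val; apply: eq_from_tnth => i.
  rewrite !tnth_mktuple permE -tnth_nth !tnth_mktuple msymX gE.
  congr 'X_[_]; apply/mnmP=> j; rewrite !mnmE.
  by rewrite (inj_eq (@perm_inj _ _)).
move=> u; rewrite mcoeff_msupp => nz i.
rewrite leqNgt; apply: contra nz => lt.
rewrite /kfold_subst comp_mpolyEX raddf_sum /= big_seq big1 // => v vs.
rewrite mcoeffZ comp_mpolyX.
under eq_bigr do rewrite tnth_mktuple.
rewrite mprodXnE mcoeffX; case: eqP => [eu|]; last by rewrite mulr0.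
suff: (u i <= k * a)%N by rewrite leqNgt lt.
rewrite -eu mnm_sumE (bigID [pred j | kfold_idx j == i]) /= addnC big1; last first.
  by move=> j /negPf ne; rewrite mulmnE mnm1E ne mul0n.
rewrite add0n -[X in (_ <= X * _)%N](kfold_idx_card i) -sum_nat_const.
apply: leq_sum => j e; rewrite mulmnE mnm1E.
by rewrite (eqP e) eqxx mul1n df.
Qed.

Definition kfold_map (f : Lambda F a (k * d)) : Lambda F (k * a) d :=
  MkLambda (kfold_subst_symle (valP f)).

Lemma kfold_map_is_linear : linear kfold_map.
Proof. by move=> c f g; apply: val_inj; rewrite /= /kfold_subst linearP. Qed.

HB.instance Definition _ :=
  GRing.isLinear.Build F (Lambda F a (k * d)) (Lambda F (k * a) d) _
    kfold_map kfold_map_is_linear.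

End KFold.

Arguments kfold_map F a d k : clear implicits.

(* Main.v *)
Require Import Defs.
From HB Require Import structures.
From mathcomp Require Import all_boot all_order all_algebra all_fingroup.
From mathcomp Require Import ssrcomplements mpoly ring zify.
From mathcomp Require Import reals complex.

Set Implicit Arguments.
Unset Strict Implicit.
Unset Printing Implicit Defensive.

Import Order.TTheory GRing.Theory Num.Theory.
Local Open Scope ring_scope.

(** Write P_j for the coefficient of t^j in the product over l < d of
    (1 + y_l t)^k.  The k-fold map is a ring morphism that sends the elementary
    symmetric polynomial e_j to P_j, and the symmetric polynomials of degree at
    most a in each variable are the combinations of products of a elementary
    symmetric polynomials (symle_spanned).  So everything is about the products
    of a given number of P_j.

    The central fact is vanish_box: if d <= r, a linear functional that
    vanishes on all products of r polynomials P_j vanishes on every symmetric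
    polynomial in y_1, ..., y_d with exponents at most k r.  For r = a this is
    surjectivity, by separation in finite dimension.  For injectivity let
    f = sum_J t_J e_(J_1) ... e_(J_a) be in the kernel, and let phi be the
    functional p |-> sum_J t_J p_J on polynomials in a variables z.  As the
    coefficients of prod_(i,l) (1 + z_i y_l)^k can be computed in two ways
    (prod_pw_duality), phi vanishes on the products of d coefficients of
    prod_i (1 + z_i t)^k; so vanish_box, with the roles of a and d exchanged,
    makes phi vanish on the symmetrized monomials, which says that the
    symmetrization of t is 0, and f is 0.

    The proof of vanish_box uses the commuting Dunkl operators
    T_i = d_i - k sum_(j <> i) (1 - s_ij) / (y_i - y_j), with a negative integral
    parameter, and the symmetric form [q, h] = (q(T) h)(0).

    Stability.  The Cauchy kernel prod_(i < r, l < d) (z_i + y_l)^k has the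
    products of r polynomials P_j as its coefficients in z, and the power sums of
    the operators in y and in z agree on it (power_sum_cauchy).  Hence the
    functionals that vanish on these products are stable under composition with
    q(T) for symmetric q (stable_sym).

    Annihilators.  Let M_m be the coefficient of t^m in e(t)^k log e(t), where
    e(t) = prod_l (1 + y_l t).  An equation of Euler, Poisson and Darboux type
    gives T_j T_i M_m = 0 for i <> j and m > k d (dunkl_dunkl_mlog); so for
    k d <= N < m the ideal of M_m is orthogonal to all polynomials with exponents
    at most N (dform_mlog_box).  In the ring of symmetric polynomials the
    elements M_(N+1), ..., M_(N+d) form a regular sequence, and the quotient by
    the ideal J_N that they generate has a one-dimensional socle, in degree N d
    (log_seq_regular, log_ideal_socle).  The functional q |-> [q, Y^N], where
    Y = y_1 ... y_d, factors through this quotient and is nonzero on the socle,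
    since [(y_1 + ... + y_d)^(N d), Y^N] = (N d)!.  Therefore a symmetric p with
    [p q, Y^N] = 0 for all symmetric q lies in J_N (log_ideal_orthogonal).  As
    J_N is 0 in degrees at most N, large N show that the form is nondegenerate
    on symmetric polynomials (dform_nondegenerate), and functionals on them are
    given by the form (dform_represent).

    Conclusion.  Let phi = [p, .] vanish on the products of r polynomials P_j and
    let N = k r.  Since Y^N = P_(k d)^r, stability gives [p q, Y^N] = 0 for all
    symmetric q, so p is in J_N and phi vanishes on the symmetric polynomials
    with exponents at most N. *)

(** * Divided differences and Dunkl operators *)

Section MpolyExtra.
Variables (A : nzRingType) (n : nat).
Implicit Types p q : {mpoly A[n]}.

Lemma msymXU (s : 'S_n) i : msym s 'X_i = 'X_(s i) :> {mpoly A[n]}.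
Proof.
rewrite msymX; congr 'X_[_]; apply/mnmP=> j; rewrite !mnmE.
by rewrite -[X in X == _](permK s) (inj_eq (@perm_inj _ _)).
Qed.

Lemma mpolyX_U (m : 'X_{1..n}) i : m i != 0%N ->
  'X_[m] = 'X_i * 'X_[m - U_(i)] :> {mpoly A[n]}.
Proof. by move=> mi; rewrite -mpolyXD addmC submK // lep1mP. Qed.

(** Induction along the multiplication by one variable, the shape in which the
    operators below are computed. *)
Lemma mpoly_indX (P : {mpoly A[n]} -> Prop) :
  P 0 -> P 1 -> (forall p q, P p -> P q -> P (p + q)) ->
  (forall c p, P p -> P (c *: p)) -> (forall i p, P p -> P ('X_i * p)) ->
  forall p, P p.
Proof.
move=> P0 P1 PD PZ PX; elim/mpolyind=> // c m p _ _ Pp.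
apply: PD => //; apply: PZ.
elim: {c p Pp} (mdeg m) {-2}m (leqnn (mdeg m)) => [|d IH] {}m.
  by rewrite leqn0 mdeg_eq0 => /eqP ->; rewrite mpolyX0.
move=> lem; have [->|/eqP nz] := m =P 0%MM; first by rewrite mpolyX0.
have [i mi] : exists i, m i != 0%N.
  apply/existsP; apply: contraR nz => /existsPn m0; apply/eqP/mnmP => i.
  by rewrite mnm0E; apply/eqP; rewrite -[_ == _]negbK.
rewrite (mpolyX_U mi); apply/PX/IH; rewrite -ltnS.
have := lem; rewrite -{1}(@submK _ U_(i) m) ?lep1mP // mdegD mdeg1 addn1.
by [].
Qed.

End MpolyExtra.

Section DivDiff.
Variables (A : idomainType) (n : nat).
Implicit Types (p q : {mpoly A[n]}) (i j l : 'I_n).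

Lemma subX_neq0 i j : i != j -> 'X_i - 'X_j != 0 :> {mpoly A[n]}.
Proof.
move=> ij; apply/eqP => /(congr1 (mcoeff U_(i))).
rewrite mcoeffB !mcoeffXU eqxx eq_sym (negPf ij) subr0 mcoeff0.
by move/eqP; rewrite oner_eq0.
Qed.

Lemma divdiff_ex i j p :
  exists q, p - msym (tperm i j) p == ('X_i - 'X_j) * q.
Proof.
elim/mpoly_indX: p => [||p q [p' /eqP Ep] [q' /eqP Eq]|c p [p' /eqP Ep]|l p [p' /eqP Ep]].
- by exists 0; rewrite raddf0 subr0 mulr0.
- by exists 0; rewrite msym1 subrr mulr0.
- by exists (p' + q'); rewrite raddfD /= opprD addrACA Ep Eq mulrDr.
- by exists (c *: p'); rewrite msymZ -scalerBr Ep scalerAr.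
exists ('X_l * p' + ((l == i)%:R - (l == j)%:R) * msym (tperm i j) p).
have -> : 'X_l * p - msym (tperm i j) ('X_l * p) =
   'X_l * (p - msym (tperm i j) p) + ('X_l - msym (tperm i j) 'X_l) * msym (tperm i j) p.
  by rewrite msymM; ring.
rewrite Ep msymXU mulrDr mulrCA; apply/eqP; congr (_ + _).
rewrite mulrA; congr (_ * _).
case: tpermP => [->|->|/eqP/negPf -> /eqP/negPf ->].
- by rewrite eqxx; case: eqP => [->|_]; rewrite ?mulr1n ?mulr0n; ring.
- by rewrite eqxx; case: eqP => [->|_]; rewrite ?mulr1n ?mulr0n; ring.
- by rewrite subrr subrr mulr0.
Qed.

Lemma divdiff_sig i j p :
  {q | p - msym (tperm i j) p = ('X_i - 'X_j) * q}.
Proof. by exists (xchoose (divdiff_ex i j p)); apply/eqP/(xchooseP (divdiff_ex i j p)). Qed.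

Definition divdiff i j p : {mpoly A[n]} := sval (divdiff_sig i j p).

Lemma divdiffE i j p : p - msym (tperm i j) p = ('X_i - 'X_j) * divdiff i j p.
Proof. by rewrite /divdiff; case: divdiff_sig. Qed.

Lemma divdiff_uniq i j p q : i != j ->
  p - msym (tperm i j) p = ('X_i - 'X_j) * q -> divdiff i j p = q.
Proof. by move=> ij; rewrite divdiffE => /(mulfI (subX_neq0 ij)). Qed.

Lemma divdiff_linear i j : i != j -> linear (divdiff i j).
Proof.
move=> ij c p q; apply: divdiff_uniq => //.
rewrite linearP /= mulrDr -scalerAr -!divdiffE scalerBr.
by rewrite opprD addrACA.
Qed.

Lemma divdiffM i j p q : i != j ->
  divdiff i j (p * q) = p * divdiff i j q + divdiff i j p * msym (tperm i j) q.
Proof.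
move=> ij; apply: divdiff_uniq => //.
by rewrite mulrDr mulrCA -divdiffE mulrA -divdiffE msymM; ring.
Qed.

Lemma divdiff_sym0 i j p : i != j -> msym (tperm i j) p = p -> divdiff i j p = 0.
Proof. by move=> ij sp; apply: divdiff_uniq; rewrite // sp subrr mulr0. Qed.

Lemma divdiffX i j l : i != j -> divdiff i j 'X_l = (l == i)%:R - (l == j)%:R.
Proof.
move=> ij; apply: divdiff_uniq => //; rewrite msymXU.
case: tpermP => [->|->|/eqP/negPf -> /eqP/negPf ->].
- by rewrite eqxx (negPf ij) subr0 mulr1.
- by rewrite eqxx eq_sym (negPf ij) sub0r mulrN1 opprB.
- by rewrite !subrr mulr0.
Qed.

Lemma msym_tpermJ (s : 'S_n) i j p :
  msym s (msym (tperm i j) p) = msym (tperm (s i) (s j)) (msym s p).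
Proof. by rewrite -!msymMm conjgC tpermJ. Qed.

Lemma msym_divdiff (s : 'S_n) i j p : i != j ->
  msym s (divdiff i j p) = divdiff (s i) (s j) (msym s p).
Proof.
move=> ij; apply/esym/divdiff_uniq; first by rewrite (inj_eq (@perm_inj _ _)).
by rewrite -msym_tpermJ -raddfB divdiffE /= msymM raddfB /= !msymXU.
Qed.

End DivDiff.

(** The Dunkl operator of the symmetric group with the parameter - k. *)
HB.lock Definition dunkl (A : idomainType) (n k : nat) (i : 'I_n)
    (p : {mpoly A[n]}) : {mpoly A[n]} :=
  p^`M(i) - (\sum_(j | j != i) divdiff i j p) *+ k.

Section Dunkl.
Variables (A : idomainType) (n k : nat).
Implicit Types (p q : {mpoly A[n]}) (i j l : 'I_n) (s : 'S_n).

Let nsym i j : j != i -> i != j. Proof. by rewrite eq_sym. Qed.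

Local Notation dunkl := (@dunkl A n k).

Lemma dunklE i p :
  dunkl i p = p^`M(i) - (\sum_(j | j != i) divdiff i j p) *+ k.
Proof. by rewrite dunkl.unlock. Qed.

Lemma dunkl_is_linear i : linear (dunkl i).
Proof.
move=> c p q; rewrite !dunklE linearP /=.
under eq_bigr => j ji do rewrite (divdiff_linear (nsym ji)).
by rewrite big_split -scaler_sumr /= mulrnDl scalerBr scalerMnr opprD addrACA.
Qed.

HB.instance Definition _ i := GRing.isLinear.Build A {mpoly A[n]} {mpoly A[n]} _
  (dunkl i) (dunkl_is_linear i).

Lemma dunklD i : {morph dunkl i : p q / p + q}. Proof. exact: raddfD. Qed.
Lemma dunklN i : {morph dunkl i : p / - p}. Proof. exact: raddfN. Qed.
Lemma dunklMn i m : {morph dunkl i : p / p *+ m}. Proof. exact: raddfMn. Qed.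
Lemma dunklZ i c p : dunkl i (c *: p) = c *: dunkl i p. Proof. exact: linearZ. Qed.
Lemma dunkl_sum i I (r : seq I) (P : pred I) (E : I -> {mpoly A[n]}) :
  dunkl i (\sum_(x <- r | P x) E x) = \sum_(x <- r | P x) dunkl i (E x).
Proof. exact: raddf_sum. Qed.

Lemma mderivXU i j : ('X_j : {mpoly A[n]})^`M(i) = (i == j)%:R.
Proof.
rewrite mderivX mnm1E eq_sym; case: eqP => [->|]; last by rewrite scale0r.
by rewrite scale1r -[X in (X - _)%MM]add0m addmK mpolyX0.
Qed.

Lemma dunklX i p : dunkl i ('X_i * p) =
  'X_i * dunkl i p + p - (\sum_(j | j != i) msym (tperm i j) p) *+ k.
Proof.
rewrite !dunklE mderivM mderivXU eqxx mul1r.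
under eq_bigr => j ji.
  rewrite (divdiffM _ _ (nsym ji)) (divdiffX A _ (nsym ji)) eqxx (negPf (nsym ji)).
  rewrite subr0 mul1r; over.
by rewrite big_split /= -mulr_sumr mulrnDl mulrBr mulrnAr; ring.
Qed.

Lemma dunklXn i l p : l != i -> dunkl i ('X_l * p) =
  'X_l * dunkl i p + msym (tperm i l) p *+ k.
Proof.
move=> li; rewrite !dunklE mderivM mderivXU eq_sym (negPf li) mul0r add0r.
under eq_bigr => j ji.
  rewrite (divdiffM _ _ (nsym ji)) (divdiffX A _ (nsym ji)) (negPf li) sub0r.
  over.
rewrite big_split /= -mulr_sumr mulrnDl mulrBr mulrnAr opprD addrA.
congr (_ + _); rewrite -mulNrn -sumrN; congr (_ *+ k).
rewrite (bigD1 l) //= eqxx mulN1r opprK big1 ?addr0 // => j /andP[_ /negPf jl].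
by rewrite eq_sym jl oppr0 mul0r oppr0.
Qed.

Lemma dunkl1 i : dunkl i 1 = 0.
Proof.
rewrite !dunklE (_ : 1^`M(i) = 0); last by rewrite -mpolyC1 mderivC.
rewrite big1 ?mul0rn ?subr0 // => j ji.
by apply: divdiff_sym0; rewrite ?msym1 1?eq_sym.
Qed.

Lemma msym_mderiv s i p : msym s (p^`M(i)) = (msym s p)^`M(s i).
Proof.
apply/mpolyP=> m; rewrite mcoeff_sym !mcoeff_deriv mcoeff_sym mnmE.
congr (_@_ _ *+ _); apply/mnmP=> j; rewrite !mnmE.
by rewrite (inj_eq (@perm_inj _ _)).
Qed.

Lemma msym_dunkl s i p : msym s (dunkl i p) = dunkl (s i) (msym s p).
Proof.
rewrite !dunklE raddfB /= msym_mderiv raddfMn /=; congr (_ - _ *+ _).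
rewrite raddf_sum /=.
under eq_bigr => j ji do rewrite (msym_divdiff _ _ (nsym ji)).
rewrite [RHS](reindex_inj (@perm_inj _ s)) /=.
by apply: eq_bigl => j; rewrite (inj_eq (@perm_inj _ _)).
Qed.

(** The commutator of two operators kills 1 and commutes with each variable:
    this is the induction along multiplication by 'X_l. *)
Lemma dunklC i j p : dunkl i (dunkl j p) = dunkl j (dunkl i p).
Proof.
have [->//|ij] := eqVneq i j.
elim/mpoly_indX: p => [||p q IHp IHq|c p IHp|l p IHp].
- by rewrite !raddf0.
- by rewrite !dunkl1 !raddf0.
- by rewrite !dunklD IHp IHq.
- by rewrite !dunklZ IHp.
wlog li : i j ij IHp / l != j.
  move=> H; have [lj|lj] := eqVneq l j; last exact: H.
  by apply/esym/H; rewrite ?lj // eq_sym.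
have [->{l li}|ni] := eqVneq l i.
  rewrite dunklXn // dunklX !dunklD dunklX dunklN dunklXn // !dunklMn dunkl_sum.
  rewrite IHp !(bigD1 (P := fun j => j != i) j) 1?eq_sym //=.
  have -> : \sum_(l | (l != i) && (l != j)) dunkl j (msym (tperm i l) p) =
            \sum_(l | (l != i) && (l != j)) msym (tperm i l) (dunkl j p).
    by apply: eq_bigr => l /andP[li lj]; rewrite msym_dunkl tpermD // eq_sym.
  rewrite !msym_dunkl [tperm j i]tpermC tpermL tpermR !mulrnDl.
  by ring.
rewrite (dunklXn p li) (dunklXn p ni) !dunklD.
rewrite (dunklXn (dunkl j p) ni) (dunklXn (dunkl i p) li).
rewrite !dunklMn IHp.
rewrite (msym_dunkl (tperm i l) j) (msym_dunkl (tperm j l) i).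
rewrite (tpermD ij li) (tpermD (nsym ij) ni).
exact: addrAC.
Qed.

End Dunkl.

(** * The action of polynomials by Dunkl operators and its bilinear form *)

Section DivDiffMonomials.
Variables (A : idomainType) (n k : nat).
Implicit Types (p q : {mpoly A[n]}) (i j l : 'I_n) (m : 'X_{1..n}).

Lemma divdiff_anti i j p : i != j -> divdiff j i p = - divdiff i j p.
Proof.
move=> ij; apply: divdiff_uniq; first by rewrite eq_sym.
by rewrite tpermC divdiffE; ring.
Qed.

Let mv i j m t : 'X_{1..n} := (m - U_(i) *+ t + U_(j) *+ t)%MM.

Lemma divdiff_mon i j m : i != j -> (m j <= m i)%N ->
  divdiff i j 'X_[m] =
  \sum_(t < m i - m j) 'X_[(m - U_(i) *+ t.+1 + U_(j) *+ t)%MM] :> {mpoly A[n]}.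
Proof.
move=> ij mij; apply: divdiff_uniq => //; rewrite mulr_sumr.
have -> : msym (tperm i j) 'X_[A, m] = 'X_[mv i j m (m i - m j)].
  rewrite msymX; congr 'X_[_]; apply/mnmP => l.
  rewrite !mnmE tpermV !mulmnE !mnm1E.
  case: tpermP => [->|->|/eqP li /eqP lj].
  - rewrite eqxx eq_sym (negPf ij) mul0n mul1n; lia.
  - rewrite eqxx (negPf ij) mul0n mul1n; lia.
  - by rewrite eq_sym (negPf li) eq_sym (negPf lj) !mul0n subn0 addn0.
rewrite -(big_mkord xpredT (fun t => ('X_i - 'X_j) * 'X_[(m - U_(i) *+ t.+1 + U_(j) *+ t)%MM])).
rewrite (eq_big_nat _ _ (F2 := fun t => - 'X_[mv i j m t.+1] - - 'X_[mv i j m t])); last first.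
  move=> t /andP[_ lt]; rewrite opprK [RHS]addrC mulrBl -!mpolyXD; congr (_ - _); congr 'X_[_].
    apply/mnmP => l; rewrite !mnmE !mulmnE !mnm1E.
    by case: eqVneq => [<-|_]; case: eqVneq => [?|_] //=; rewrite ?mul1n ?mul0n; lia.
  apply/mnmP => l; rewrite !mnmE !mulmnE !mnm1E.
  by case: eqVneq => [<-|_]; case: eqVneq => [?|_] //=; rewrite ?mul1n ?mul0n; lia.
rewrite telescope_sumr // opprK [RHS]addrC; congr (_ - _); congr 'X_[_].
by rewrite /mv !mulm0n subm0 addm0.
Qed.

(** Every monomial of a divided difference arises from a monomial of the
    polynomial by moving a part of the larger of two exponents to the smaller
    one; this is why bounds on the exponents survive. *)
Lemma divdiff_ind (S : {mpoly A[n]} -> Prop) i j m : i != j ->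
  S 0 -> (forall p q, S p -> S q -> S (p + q)) -> (forall p, S p -> S (- p)) ->
  (forall m', (mdeg m = (mdeg m').+1) ->
     (forall l, m' l <= maxn (m l) (maxn (m i) (m j)))%N -> S 'X_[m']) ->
  S (divdiff i j 'X_[m]).
Proof.
move=> ij S0 SD SN SX.
wlog mij : i j ij SX / (m j <= m i)%N.
  move=> H; have [mij|/ltnW mij] := leqP (m j) (m i); first exact: H.
  rewrite -[divdiff _ _ _]opprK -divdiff_anti //; apply/SN/H => //.
    by rewrite eq_sym.
  by move=> m' d le; apply: SX => // l; rewrite [maxn (m i) _]maxnC.
rewrite divdiff_mon //; elim/big_ind: _ => // t _.
have lt := ltn_ord t; apply: SX => [|l].
  have le : (U_(i) *+ t.+1 <= m)%MM.
    by apply/mnm_lepP => l; rewrite mulmnE mnm1E; case: eqVneq => [<-|_] /=; lia.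
  rewrite mdegD mdegMn mdeg1 mul1n.
  by rewrite -{1}(submK le) mdegD mdegMn mdeg1 mul1n; lia.
rewrite !mnmE !mulmnE !mnm1E; case: (eqVneq i l) => [<-|_].
  by rewrite eq_sym (negPf ij) mul1n mul0n; lia.
by case: eqVneq => [<-|_]; rewrite ?mul1n ?mul0n; lia.
Qed.

(** The properties that pass from p to its image under an operator: those that
    only depend on the degree and on upper bounds for all exponents. *)
Lemma dunkl_ind (S : {mpoly A[n]} -> Prop) i p :
  S 0 -> (forall p q, S p -> S q -> S (p + q)) -> (forall c p, S p -> S (c *: p)) ->
  (forall m m', m \in msupp p -> (mdeg m = (mdeg m').+1) ->
    (forall N, (forall l, m l <= N) -> (forall l, m' l <= N))%N -> S 'X_[m']) ->
  S (dunkl k i p).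
Proof.
move=> S0 SD SZ SX; have SN q : S q -> S (- q) by rewrite -scaleN1r; apply: SZ.
rewrite [p]mpolyE dunkl_sum big_seq; elim/big_ind: _ => // m mp.
rewrite dunklZ; apply/SZ; rewrite dunklE; apply/SD; last apply/SN.
  rewrite mderivX; have [->|mi] := eqVneq (m i) 0%N; first by rewrite scale0r.
  apply/SZ/(SX m) => // [|N le l].
    by rewrite -{1}(@submK _ U_(i) m) ?lep1mP // mdegD mdeg1 addn1.
  by rewrite mnmBE; apply: leq_trans (le l); rewrite leq_subr.
rewrite -scaler_nat; apply/SZ; elim/big_ind: _ => // j ji.
apply: divdiff_ind => // [|m' d le]; first by rewrite eq_sym.
apply: (SX m) => // N leN l; apply: leq_trans (le l) _.
by rewrite !geq_max !leN.
Qed.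

Definition box N p := forall m l, (N < m l)%N -> p@_m = 0.

Lemma boxX N m : (forall l, m l <= N)%N -> box N 'X_[m].
Proof.
move=> le m' l lt; rewrite mcoeffX; case: eqP => // E.
by move: lt; rewrite -E ltnNge le.
Qed.

Lemma box0 N : box N 0. Proof. by move=> m l _; rewrite mcoeff0. Qed.

Lemma boxD N p q : box N p -> box N q -> box N (p + q).
Proof. by move=> bp bq m l lt; rewrite mcoeffD (bp _ _ lt) (bq _ _ lt) addr0. Qed.

Lemma boxZ N c p : box N p -> box N (c *: p).
Proof. by move=> bp m l lt; rewrite mcoeffZ (bp _ _ lt) mulr0. Qed.

Lemma box_msupp N p m : box N p -> m \in msupp p -> forall l, (m l <= N)%N.
Proof. by move=> bp mp l; rewrite leqNgt; apply: contraL mp => /bp; rewrite mcoeff_msupp => ->; rewrite eqxx. Qed.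

Lemma box_dunkl N i p : box N p -> box N (dunkl k i p).
Proof.
move=> bp; apply: (dunkl_ind (S := box N)); [exact: box0 | exact: boxD | exact: boxZ |].
by move=> m m' mp _ H; apply/boxX/H/(box_msupp bp mp).
Qed.

Lemma dunkl_homog d i p : p \is d.+1.-homog -> dunkl k i p \is d.-homog.
Proof.
move=> hp; apply: (dunkl_ind (S := fun q => q \is d.-homog)); [exact: rpred0 | exact: rpredD | by move=> c q; apply: rpredZ |].
move=> m m' mp dm _; rewrite dhomogX.
by have := dhomog_mf hp mp; rewrite /= dm => -[->].
Qed.

Lemma dunkl_homog0 i p : p \is 0.-homog -> dunkl k i p = 0.
Proof.
move=> hp; apply: (dunkl_ind (S := fun p => p = 0)) => // [q r -> ->|c q ->|].
- by rewrite addr0.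
- by rewrite scaler0.
by move=> m m' mp dm _; have := dhomog_mf hp mp; rewrite /= dm.
Qed.

End DivDiffMonomials.

Section DunklMonomials.
Variables (A : idomainType) (n k : nat).
Implicit Types (p q : {mpoly A[n]}) (i j l : 'I_n) (m : 'X_{1..n}).
Local Notation T := (@dunkl A n k).

Definition mword m : seq 'I_n := flatten [seq nseq (m i) i | i <- enum 'I_n].

Lemma count_mword m i : count_mem i (mword m) = m i.
Proof.
rewrite /mword count_flatten -map_comp sumnE big_map big_enum /=.
rewrite (bigD1 i) //= count_nseq /= eqxx mul1n big1 ?addn0 // => j ji.
by rewrite count_nseq /= (negPf ji) mul0n.
Qed.

Lemma foldr_dunkl_perm s1 s2 p : perm_eq s1 s2 -> foldr T p s1 = foldr T p s2.
Proof.
elim: s1 s2 => [|i s1 IH] s2; first by rewrite perm_sym => /perm_nilP ->.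
move=> E; have is2 : i \in s2 by rewrite -(perm_mem E) mem_head.
case/splitPr: is2 E => t1 t2.
rewrite perm_sym perm_catC cat_cons perm_cons perm_catC perm_sym => /IH /= ->.
elim: t1 => //= j t1 <-; exact: dunklC.
Qed.

Definition dunklm m p := foldr T p (mword m).

Lemma dunklm0 p : dunklm 0 p = p.
Proof.
rewrite /dunklm (_ : mword 0 = [::]) //; rewrite /mword.
by elim: (enum _) => //= i s ->; rewrite mnm0E.
Qed.

Lemma dunklmU i m p : dunklm (U_(i) + m) p = T i (dunklm m p).
Proof.
rewrite -[RHS]/(foldr T p (i :: mword m)); apply: foldr_dunkl_perm.
apply/allP => j _ /=; apply/eqP; rewrite !count_mword mnmDE mnm1E.
by rewrite eq_sym.
Qed.

Lemma dunklm_linear m : linear (dunklm m).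
Proof.
move=> c p q; rewrite /dunklm; elim: (mword m) => //= i s ->.
by rewrite dunklD dunklZ.
Qed.


End DunklMonomials.

(** The polynomial q in the commuting operators T_i, applied to p. *)
HB.lock Definition act (A : idomainType) (n k : nat) (q p : {mpoly A[n]}) :
  {mpoly A[n]} := \sum_(m <- msupp q) q@_m *: dunklm k m p.

Section Action.
Variables (A : idomainType) (n k : nat).
Implicit Types (p q r : {mpoly A[n]}) (i j l : 'I_n) (m : 'X_{1..n}).
Local Notation T := (@dunkl A n k).
Local Notation dunklm := (@dunklm A n k).
Local Notation act := (@act A n k).

Lemma actE q p : act q p = \sum_(m <- msupp q) q@_m *: dunklm m p.
Proof. by rewrite act.unlock. Qed.

Lemma actwE q p b : (msize q <= b)%N ->
  act q p = \sum_(m : 'X_{1..n < b}) q@_m *: dunklm m p.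
Proof.
move=> le; rewrite actE (big_mksub 'X_{1..n < b}) /=; first last.
- by move=> x /msize_mdeg_lt /leq_trans; apply.
- by rewrite msupp_uniq.
rewrite big_rmcond //= => m /memN_msupp_eq0 ->; by rewrite scale0r.
Qed.

Lemma act_linearl c q r p : act (c *: q + r) p = c *: act q p + act r p.
Proof.
set b := maxn (msize (c *: q + r)) (maxn (msize q) (msize r)).
rewrite !(@actwE _ _ b) ?leq_max ?leqnn ?orbT // scaler_sumr -big_split /=.
by apply: eq_bigr => m _; rewrite mcoeffD mcoeffZ scalerDl scalerA.
Qed.

Lemma act_linear q : linear (act q).
Proof.
move=> c p r; rewrite !actE scaler_sumr -big_split /=; apply: eq_bigr => m _.
by rewrite dunklm_linear scalerDr !scalerA mulrC.
Qed.

HB.instance Definition _ q := GRing.isLinear.Build A {mpoly A[n]} {mpoly A[n]} _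
  (act q) (act_linear q).

Definition actr p q := act q p.

Lemma actr_linear p : linear (actr p).
Proof. by move=> c q r; exact: act_linearl. Qed.

HB.instance Definition _ p := GRing.isLinear.Build A {mpoly A[n]} {mpoly A[n]} _
  (actr p) (actr_linear p).

Lemma act0l p : act 0 p = 0. Proof. exact: (raddf0 (actr p)). Qed.
Lemma actDl q r p : act (q + r) p = act q p + act r p.
Proof. exact: (raddfD (actr p)). Qed.
Lemma actZl c q p : act (c *: q) p = c *: act q p.
Proof. by rewrite -[c *: q]addr0 act_linearl act0l addr0. Qed.
Lemma act_suml I (s : seq I) P (E : I -> {mpoly A[n]}) p :
  act (\sum_(x <- s | P x) E x) p = \sum_(x <- s | P x) act (E x) p.
Proof. exact: (raddf_sum (actr p)). Qed.

Lemma actX m p : act 'X_[m] p = dunklm m p.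
Proof. by rewrite actE msuppX big_seq1 mcoeffX eqxx scale1r. Qed.

Lemma act1 p : act 1 p = p.
Proof. by rewrite -mpolyX0 actX dunklm0. Qed.

Lemma actXM i q p : act ('X_i * q) p = T i (act q p).
Proof.
elim/mpolyind: q => [|c m q _ _ IH]; first by rewrite mulr0 !act0l raddf0.
rewrite mulrDr -scalerAr -mpolyXD !actDl !actZl !actX dunklmU IH.
by rewrite dunklD dunklZ.
Qed.

Lemma actM q r p : act (q * r) p = act q (act r p).
Proof.
elim/mpoly_indX: q => [||q q' IH IH'|c q IH|i q IH].
- by rewrite mul0r !act0l.
- by rewrite mul1r act1.
- by rewrite mulrDl !actDl IH IH'.
- by rewrite -scalerAl !actZl IH.
- by rewrite -mulrA !actXM IH.
Qed.

Lemma dunkl_act i q p : T i (act q p) = act q (T i p).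
Proof. by rewrite -actXM mulrC actM -['X_i]mulr1 actXM act1. Qed.

Lemma msym_act s q p : msym s (act q p) = act (msym s q) (msym s p).
Proof.
elim/mpoly_indX: q => [||q q' IH IH'|c q IH|i q IH].
- by rewrite !raddf0 !act0l raddf0.
- by rewrite msym1 !act1.
- by rewrite raddfD /= !actDl raddfD /= IH IH'.
- by rewrite msymZ !actZl msymZ IH.
- by rewrite msymM msymXU !actXM msym_dunkl IH.
Qed.

Lemma box_act N q p : box N p -> box N (act q p).
Proof.
move=> bp; rewrite actE; elim/big_ind: _ => [||m _]; [exact: box0 | exact: boxD |].
apply: boxZ; rewrite /dunklm; elim: (mword m) => //= i s; exact: box_dunkl.
Qed.

Lemma size_mword m : size (mword m) = mdeg m.
Proof.
rewrite /mword size_flatten /shape -map_comp sumnE big_map big_enum mdegE /=.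
by apply: eq_bigr => i _; rewrite size_nseq.
Qed.

Lemma foldr_dunkl_homog d e p s : size s = d -> p \is e.-homog ->
  (d <= e -> foldr T p s \is (e - d).-homog)%N /\ ((e < d)%N -> foldr T p s = 0).
Proof.
elim: s d => [|i s IH] d <- /= hp; first by rewrite subn0.
have [h1 h2] := IH _ erefl hp; split=> lt.
  apply: dunkl_homog; rewrite (_ : (e - (size s).+1).+1 = e - size s)%N; last by lia.
  by apply: h1; apply: ltnW.
have [/h2 ->|le] := ltnP e (size s); first by rewrite raddf0.
by apply: dunkl_homog0; have := h1 le; rewrite (_ : e - size s = 0)%N //; lia.
Qed.

Lemma act_homog d e q p : q \is d.-homog -> p \is e.-homog -> (d <= e)%N ->
  act q p \is (e - d).-homog.
Proof.
move=> hq hp de; rewrite actE big_seq; apply: rpred_sum => m mq; apply: rpredZ.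
have sz : size (mword m) = d by rewrite size_mword; exact: (dhomog_mf hq mq).
by have [+ _] := foldr_dunkl_homog sz hp; apply.
Qed.

Lemma act_homog0 d e q p : q \is d.-homog -> p \is e.-homog -> (e < d)%N ->
  act q p = 0.
Proof.
move=> hq hp de; rewrite actE big_seq big1 // => m mq.
have sz : size (mword m) = d by rewrite size_mword; exact: (dhomog_mf hq mq).
by have [_ +] := foldr_dunkl_homog sz hp; rewrite /dunklm => ->; rewrite ?scaler0.
Qed.

Definition dform q p := (act q p)@_0%MM.

Lemma dform_homog_neq d e q p : q \is d.-homog -> p \is e.-homog -> d != e ->
  dform q p = 0.
Proof.
move=> hq hp; rewrite /dform neq_ltn => /orP[lt|lt]; last first.
  by rewrite (act_homog0 hq hp lt) mcoeff0.
have := act_homog hq hp (ltnW lt); move/dhomog_nemf_coeff; apply.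
by rewrite /= mdeg0 eq_sym -lt0n subn_gt0.
Qed.

Lemma dformMl q r p : dform (q * r) p = dform q (act r p).
Proof. by rewrite /dform actM. Qed.

Lemma mcoeff0_msym s p : (msym s p)@_0%MM = p@_0%MM.
Proof. by rewrite mcoeff_sym; congr (_@_ _); apply/mnmP=> i; rewrite !mnmE. Qed.

Lemma dform_msym s q p : dform (msym s q) (msym s p) = dform q p.
Proof. by rewrite /dform -msym_act mcoeff0_msym. Qed.

Lemma mcoeff0_Xmul i p : ('X_i * p)@_0%MM = 0.
Proof.
rewrite mulrC; have := @mcoeff0_is_multiplicative n A => -[H _].
by rewrite H mcoeffX mnm1_eq0 mulr0.
Qed.

(** Multiplication by 'X_i is adjoint to T_i. For a product 'X_l q this follows
    from the commutation rule of T_i and 'X_l, whose extra terms are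
    transpositions, and these are isometries. *)
Lemma dform_adj q i p : dform q ('X_i * p) = dform (T i q) p.
Proof.
elim/mpoly_indX: q i p => [||q q' IH IH'|c q IH|l q IH] i p.
- by rewrite raddf0 /dform !act0l mcoeff0.
- by rewrite dunkl1 /dform act0l act1 mcoeff0_Xmul mcoeff0.
- by rewrite dunklD /dform !actDl !mcoeffD -!/(dform _ _) IH IH'.
- by rewrite dunklZ /dform !actZl !mcoeffZ -!/(dform _ _) IH.
have pairXl r p' : dform ('X_l * r) p' = dform r (T l p').
  by rewrite mulrC dformMl -['X_l]mulr1 actXM act1.
have dform_tp r p' h j : dform r (msym (tperm h j) p') = dform (msym (tperm h j) r) p'.
  rewrite -(dform_msym (tperm h j)); congr dform.
  by rewrite -msymMm tperm2 msym1m.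
have pD r p1 p2 : dform r (p1 + p2) = dform r p1 + dform r p2.
  by rewrite /dform raddfD mcoeffD.
have pN r p1 : dform r (- p1) = - dform r p1 by rewrite /dform raddfN mcoeffN.
have pMn r p1 : dform r (p1 *+ k) = dform r p1 *+ k by rewrite /dform raddfMn mcoeffMn.
have pDl r1 r2 p1 : dform (r1 + r2) p1 = dform r1 p1 + dform r2 p1.
  by rewrite /dform actDl mcoeffD.
have pNl r p1 : dform (- r) p1 = - dform r p1.
  by rewrite /dform -scaleN1r actZl mcoeffZ mulN1r.
have pMnl r p1 : dform (r *+ k) p1 = dform r p1 *+ k.
  by rewrite /dform -scaler_nat actZl mcoeffZ mulr_natl.
rewrite pairXl; have [<-{i}|li] := eqVneq l i.
  rewrite !dunklX !pD !pDl !pN !pNl !pMn !pMnl IH pairXl; congr (_ + _ - _ *+ _).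
  rewrite /dform act_suml !raddf_sum; apply: eq_bigr => j jl.
  exact: dform_tp.
rewrite dunklXn 1?eq_sym // dunklXn // pD pDl pMn pMnl IH pairXl.
by rewrite tpermC dform_tp.
Qed.

(** Adjointness moves the variables of one argument to the other one by one. *)
Lemma dformC q p : dform q p = dform p q.
Proof.
elim/mpoly_indX: p q => [||p p' IH IH'|c p IH|i p IH] q.
- by rewrite /dform act0l raddf0.
- rewrite {2}/dform act1; elim/mpoly_indX: q => [||q q' IH IH'|c q IH|l q IH].
  + by rewrite /dform act0l.
  + by rewrite /dform act1.
  + by rewrite /dform actDl !mcoeffD -!/(dform _ _) IH IH'.
  + by rewrite /dform actZl !mcoeffZ -!/(dform _ _) IH.
  + by rewrite /dform actXM dunkl_act dunkl1 raddf0 mcoeff0_Xmul mcoeff0.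
- by rewrite /dform actDl raddfD /= !mcoeffD -!/(dform _ _) IH IH'.
- by rewrite /dform actZl linearZ /= !mcoeffZ -!/(dform _ _) IH.
by rewrite dform_adj IH /dform actXM dunkl_act.
Qed.

End Action.

(** * The coefficients of e(t)^k log e(t) *)

Section Derivation.
Variables (S : comNzRingType) (D : S -> S).
Hypothesis DM : forall x y, D (x * y) = D x * y + x * D y.

Lemma derivation1 : D 1 = 0.
Proof. by apply: (addIr (D 1)); rewrite add0r -{3}[1]mulr1 DM mulr1 mul1r. Qed.

Lemma derivation_prod (I : finType) (f : I -> S) :
  D (\prod_i f i) = \sum_i D (f i) * \prod_(j | j != i) f j.
Proof.
elim: (index_enum I) (index_enum_uniq I) => [_|i r IH /= /andP[ir ur]].
  by rewrite !big_nil derivation1.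
rewrite !big_cons DM {}IH // eqxx; congr (_ * _ + _).
  rewrite big_seq [RHS]big_seq_cond; apply: eq_bigl => j.
  by case: eqP => [->|_]; rewrite ?(negPf ir) ?andbT.
rewrite mulr_sumr !big_seq; apply: eq_bigr => j jr.
rewrite big_cons (_ : i != j) 1?mulrCA //.
by apply: contraNneq ir => ->.
Qed.

Lemma derivation_exp x m : D (x ^+ m) = (D x * x ^+ m.-1) *+ m.
Proof.
case: m => [|m]; first by rewrite expr0 derivation1.
elim: m => [|m IH]; first by rewrite expr0 mulr1.
rewrite exprS DM {}IH /= -mulrnAr [X in _ + X]mulrCA mulrnAr -exprS.
by rewrite [in RHS]mulrSr addrC -mulrnAr.
Qed.

End Derivation.

Section ElementarySeries.
Variables (F : numFieldType) (n : nat).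
Local Notation P := {mpoly F[n]}.
Implicit Types (p q : {poly P}) (i j : 'I_n).

Definition gen_elem : {poly P} := \prod_(j < n) (1 + 'X_j *: 'X).
Definition gen_elem' i : {poly P} := \prod_(j < n | j != i) (1 + 'X_j *: 'X).

Lemma gen_elemE i : gen_elem = (1 + 'X_i *: 'X) * gen_elem' i.
Proof. by rewrite /gen_elem (bigD1 i). Qed.

Lemma coef_gen_elem m : gen_elem`_m = mesym n F m.
Proof.
rewrite /gen_elem; under eq_bigr do rewrite addrC.
rewrite bigA_distr coef_sum mesymE [RHS](eq_bigl (fun h : {set 'I_n} => #|h| == m)) //.
rewrite [RHS]big_mkcond /=; apply: eq_bigr => h _.
rewrite -big_mkcond /= scaler_prod prodr_const coefZ coefXn [m == _]eq_sym.
case: ifP => _; last by rewrite mulr0.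
rewrite mulr1 mprodXE; congr 'X_[_]; apply/mnmP => j.
rewrite mnm_sumE mnmE (eq_bigr (fun i => (i == j) : nat)) => [|i _]; last by rewrite mnm1E.
rewrite -big_mkcondr /= sum1_card; case jh: (j \in h).
  by rewrite (eq_card (B := pred1 j)) ?card1 // => i; rewrite !inE unfold_in /= andbC; case: eqP => // ->.
by rewrite eq_card0 // => i; rewrite !inE unfold_in /= andbC; case: eqP => // ->.
Qed.

Lemma deriv_gen_elem : gen_elem^`() = \sum_j 'X_j *: gen_elem' j.
Proof.
rewrite (derivation_prod (@derivM _)); apply: eq_bigr => j _.
by rewrite derivD derivC add0r derivZ derivX -scalerAl mul1r.
Qed.

Definition psum m : P := \sum_(j < n) 'X_j ^+ m.

Definition logc m : P := ((-1) ^+ m.-1 / m%:R) *: psum m.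
Definition logt b : {poly P} := \poly_(m < b.+1) logc m.

Lemma logc0 : logc 0 = 0.
Proof. by rewrite /logc invr0 mulr0 scale0r. Qed.

(** The identity e (log e)' = e', where log e is truncated at order b. *)
Lemma logc_deriv b : gen_elem * (logt b)^`() = gen_elem^`() +
  'X^b * \sum_j (- ((- 'X_j) ^+ b * 'X_j) *: gen_elem' j).
Proof.
have -> : (logt b)^`() = \sum_j \sum_(m < b) ('X_j * (- 'X_j) ^+ m) *: 'X^m.
  apply/polyP => m; rewrite coef_deriv coef_poly coef_sum.
  under [RHS]eq_bigr => j _ do rewrite coef_sum.
  rewrite ltnS; case: ltnP => mb.
    under [RHS]eq_bigr => j _.
      rewrite (bigD1 (Ordinal mb)) //= coefZ coefXn eqxx mulr1 big1 ?addr0; last first.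
        by move=> l /negPf; rewrite coefZ coefXn -val_eqE /= eq_sym => ->; rewrite mulr0.
      over.
    rewrite /logc /psum /= -scaler_nat !scaler_sumr; apply: eq_bigr => j _.
    rewrite scalerA mulrC -mulrA mulVf ?pnatr_eq0 // mulr1 [(- 'X_j) ^+ m]exprNn mulrCA -exprS.
    by rewrite -mul_mpolyC rmorphXn rmorphN rmorph1.
  rewrite mul0rn big1 // => j _; rewrite big1 // => l _.
  by rewrite coefZ coefXn gtn_eqF ?mulr0 // (leq_trans (ltn_ord l)).
rewrite deriv_gen_elem !mulr_sumr -big_split; apply: eq_bigr => j _ /=.
rewrite (gen_elemE j) mulrC mulrA.
have -> : (\sum_(m < b) ('X_j * (- 'X_j) ^+ m) *: 'X^m) * (1 + 'X_j *: 'X) =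
  ('X_j)%:P - ('X_j * (- 'X_j) ^+ b) *: 'X^b :> {poly P}.
  elim: b => [|b IH]; first by rewrite big_ord0 mul0r !expr0 mulr1 alg_polyC subrr.
  rewrite big_ord_recr /= mulrDl IH -!mul_polyC !polyCM !rmorphXn /= polyCN !exprS; ring.
by rewrite -!mul_polyC !(polyCM, polyCN); ring.
Qed.

Lemma derivation_map_poly i p q :
  map_poly (mderiv i) (p * q) = map_poly (mderiv i) p * q + p * map_poly (mderiv i) q.
Proof.
apply/polyP => m; rewrite coefD coef_map !coefM raddf_sum -big_split /=.
by apply: eq_bigr => j _; rewrite !coef_map mderivM.
Qed.

Local Notation D i := (map_poly (@mderiv n F i)).

Lemma mderiv_sum i I (r : seq I) (E : I -> P) :
  (\sum_(x <- r) E x)^`M(i) = \sum_(x <- r) (E x)^`M(i).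
Proof. exact: raddf_sum. Qed.

Lemma mderiv_gen_elem i : D i gen_elem = 'X * gen_elem' i.
Proof.
rewrite /gen_elem (derivation_prod (derivation_map_poly i)) (bigD1 i) //=.
have Dj j : D i (1 + 'X_j *: 'X) = (i == j)%:R *: 'X.
  apply/polyP => m; rewrite coef_map !coefD !coefZ !coefX !coef1 /= mderivD.
  case: m => [|[|m]] /=; rewrite ?mulr0 ?mulr1 ?mderiv0 ?addr0 ?add0r //.
    by rewrite -mpolyC1 mderivC.
  by rewrite mderivXU.
rewrite Dj eqxx scale1r [X in _ + X]big1 ?addr0 // => j ji.
by rewrite Dj eq_sym (negPf ji) scale0r mul0r.
Qed.

Lemma mderiv_logt i b :
  (1 + 'X_i *: 'X) * D i (logt b) = 'X - ((- 'X_i) ^+ b) *: 'X^(b.+1).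
Proof.
have -> : D i (logt b) = 'X * \sum_(m < b) ((- 'X_i) ^+ m) *: 'X^m.
  apply/polyP => -[|m]; rewrite coef_map coef_poly coefXM /=.
    by rewrite logc0 mderiv0.
  rewrite ltnS coef_sum; case: ltnP => mb; last first.
    rewrite mderiv0 big1 // => l _.
    by rewrite coefZ coefXn gtn_eqF ?mulr0 // (leq_trans (ltn_ord l)).
  rewrite (bigD1 (Ordinal mb)) //= coefZ coefXn eqxx mulr1 big1 ?addr0; last first.
    by move=> l /negPf; rewrite coefZ coefXn -val_eqE /= eq_sym => ->; rewrite mulr0.
  rewrite /logc /psum mderivZ mderiv_sum (bigD1 i) //= big1 ?addr0; last first.
    move=> j ji; rewrite (derivation_exp (mderivM i)) mderivXU eq_sym (negPf ji).
    by rewrite mul0r mul0rn.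
  rewrite (derivation_exp (mderivM i)) mderivXU eqxx mul1r -scaler_nat scalerA.
  rewrite mulfVK ?pnatr_eq0 // [(- 'X_i) ^+ m]exprNn.
  by rewrite -mul_mpolyC rmorphXn rmorphN rmorph1.
rewrite mulrCA.
have -> : (1 + 'X_i *: 'X) * (\sum_(m < b) ((- 'X_i) ^+ m) *: 'X^m) =
    1 - ((- 'X_i) ^+ b) *: 'X^b :> {poly P}.
  elim: b => [|b IH]; first by rewrite big_ord0 mulr0 !expr0 scale1r subrr.
  by rewrite big_ord_recr /= mulrDr IH -!mul_polyC !rmorphXn /= polyCN !exprS; ring.
by rewrite mulrBr mulr1 -scalerAr -exprS.
Qed.

Variable k : nat.

Definition pw : {poly P} := gen_elem ^+ k.

(** The coefficient of t^m in e(t)^k log e(t); the logarithm is truncated at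
    order m, which does not change this coefficient. *)
Definition mlog m : P := (pw * logt m)`_m.

Lemma mlogE m b : (m <= b)%N -> (pw * logt b)`_m = mlog m.
Proof.
move=> mb; rewrite /mlog !coefM; apply: eq_bigr => j _; congr (_ * _).
by rewrite !coef_poly !ltnS leq_subr (leq_trans (leq_subr _ _) mb).
Qed.

Lemma mderiv_pw i : (1 + 'X_i *: 'X) * D i pw = ('X * pw) *+ k.
Proof.
rewrite /pw (derivation_exp (derivation_map_poly i)) mderiv_gen_elem.
case: k => [|k']; first by rewrite !mulr0n mulr0.
by rewrite mulrnAr /= exprS {2}(gen_elemE i); congr (_ *+ _); ring.
Qed.

Lemma mderiv_mlog i m :
  (mlog m.+1)^`M(i) + 'X_i * (mlog m)^`M(i) = mlog m *+ k + pw`_m.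
Proof.
pose b := m.+1.
have E : (1 + 'X_i *: 'X) * D i (pw * logt b) =
  ('X * (pw * logt b)) *+ k + 'X * pw - 'X^(b.+1) * (((- 'X_i) ^+ b) *: pw).
  rewrite derivation_map_poly [LHS]mulrDr.
  rewrite [X in X + _]mulrA mderiv_pw [X in _ + X]mulrCA mderiv_logt.
  by rewrite -!mul_polyC; ring.
have := congr1 (fun p : {poly P} => p`_m.+1) E.
rewrite mulrDl mul1r -scalerAl coefB coefXnM ltnSn subr0 !coefD !coefZ coefMn !coefXM /=.
by rewrite !coef_map /= !mlogE.
Qed.

(** The coefficient of t^m in e (e^k log e)' = k e' (e^k log e) + e' e^k. *)
Lemma mlog_rec m :
  \sum_(j < m.+1) (mesym n F j * mlog (m - j).+1) *+ (m - j).+1 =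
  \sum_(j < m.+1) (mesym n F j.+1 * mlog (m - j)) *+ (k * j.+1) +
  \sum_(j < m.+1) (mesym n F j.+1 * pw`_(m - j)) *+ j.+1.
Proof.
pose b := m.+1.
have [J E] : exists J, gen_elem * (pw * logt b)^`() =
  (gen_elem^`() * (pw * logt b)) *+ k + gen_elem^`() * pw + 'X^b * J.
  exists (pw * \sum_j (- ((- 'X_j) ^+ b * 'X_j) *: gen_elem' j)).
  rewrite derivM [LHS]mulrDr [X in X + _]mulrA [X in _ + X]mulrCA logc_deriv.
  have -> : gen_elem * pw^`() = (gen_elem^`() * pw) *+ k.
    rewrite /pw deriv_exp; case: k => [|k']; first by rewrite !mulr0n mulr0.
    by rewrite mulrnAr /= exprS; congr (_ *+ _); ring.
  by ring.
have := congr1 (fun p : {poly P} => p`_m) E.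
rewrite !coefD coefXnM ltnSn addr0 coefMn !coefM => E'.
transitivity (\sum_(j < m.+1) gen_elem`_j * (pw * logt b)^`()`_(m - j)).
  apply: eq_bigr => j _; rewrite coef_gen_elem coef_deriv mlogE ?mulrnAr //.
  by rewrite ltnS leq_subr.
rewrite E' -sumrMnl; congr (_ + _); apply: eq_bigr => j _; rewrite coef_deriv coef_gen_elem.
  by rewrite mlogE ?mulrnAl -?mulrnA 1?mulnC // (leq_trans (leq_subr _ _)).
by rewrite mulrnAl.
Qed.

Lemma size_gen_elem : (size gen_elem <= n.+1)%N.
Proof.
apply/leq_sizeP => m nm; rewrite coef_gen_elem; apply: mesym_geqnE.
by [].
Qed.

Lemma size_pw : (size pw <= (k * n).+1)%N.
Proof.
rewrite /pw; elim: k => [|k' IH]; first by rewrite expr0 size_poly1.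
rewrite exprS; apply: leq_trans (size_polyMleq _ _) _.
have := size_gen_elem; have := IH; lia.
Qed.

Definition graded p := forall m, p`_m \is m.-homog.

Lemma gradedM p q : graded p -> graded q -> graded (p * q).
Proof.
move=> gp gq m; rewrite coefM; apply: rpred_sum => j _.
have := dhomogM (gp j) (gq (m - j)%N); rewrite subnKC //.
by rewrite -ltnS.
Qed.

Lemma graded_gen_elem : graded gen_elem.
Proof. by move=> m; rewrite coef_gen_elem dhomog_mesym. Qed.

Lemma graded_pw : graded pw.
Proof.
rewrite /pw; elim: k => [|k' IH]; last by rewrite exprS; apply: gradedM => //; exact: graded_gen_elem.
by move=> m; rewrite expr0 coef1; case: m => [|m]; rewrite ?dhomog1 ?dhomog0.
Qed.

Lemma mlog_homog m : mlog m \is m.-homog.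
Proof.
apply: gradedM => [|l]; first exact: graded_pw.
rewrite coef_poly; case: ifP => _; last exact: dhomog0.
rewrite /logc; apply: rpredZ; rewrite /psum; apply: rpred_sum => j _.
by rewrite mpolyXn dhomogX /= mdegMn mdeg1 mul1n.
Qed.

Lemma pw_sym m : pw`_m \is symmetric.
Proof.
rewrite /pw; elim: k m => [|k' IH] m.
  by rewrite expr0 coef1; case: (m == 0)%N; rewrite ?rpred0 ?rpred1.
rewrite exprS coefM; apply: rpred_sum => j _; apply: rpredM => //.
by rewrite coef_gen_elem mesym_sym.
Qed.

Lemma psum_sym m : psum m \is symmetric.
Proof.
apply/issymP => s; rewrite /psum raddf_sum /= [RHS](reindex_inj (@perm_inj _ s)) /=.
by apply: eq_bigr => j _; rewrite rmorphXn /= msymXU.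
Qed.

Lemma mlog_sym m : mlog m \is symmetric.
Proof.
rewrite /mlog coefM; apply: rpred_sum => j _; apply: rpredM; first exact: pw_sym.
rewrite coef_poly; case: ifP => _; last exact: rpred0.
by apply: rpredZ; exact: psum_sym.
Qed.

(** On a symmetric polynomial T_i is d_i, and T_j d_i M = d_j d_i M plus a
    divided difference. Applying d_j to
    d_i M_(m+1) + 'X_i d_i M_m = k M_m + (e^k)_m and subtracting the equation with
    i and j exchanged gives the result, because (e^k)_m = 0 for m > k n. *)
Lemma dunkl_dunkl_mlog i j m : i != j -> (k * n < m)%N ->
  dunkl k j (dunkl k i (mlog m)) = 0.
Proof.
move=> ij km; have sM s : msym s (mlog m) = mlog m by move/issymP: (mlog_sym m); apply.
have Ti : dunkl k i (mlog m) = (mlog m)^`M(i).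
  rewrite dunklE big1 ?mul0rn ?subr0 // => l li.
  by apply: divdiff_sym0; rewrite 1?eq_sym.
rewrite Ti dunklE (bigD1 i) //= big1 ?addr0; last first.
  move=> l /andP[lj li]; apply: divdiff_sym0; first by rewrite eq_sym.
  by rewrite msym_mderiv sM tpermD // eq_sym.
have ji : j != i by rewrite eq_sym.
(* Multiplication by 'X_j - 'X_i turns the divided difference into a difference. *)
apply: (mulfI (subX_neq0 F ji)); rewrite mulr0 mulrBr mulrnAr -divdiffE.
rewrite msym_mderiv sM tpermR.
have Ei := congr1 (mderiv j) (mderiv_mlog i m).
have Ej := congr1 (mderiv i) (mderiv_mlog j m).
have pw0 : pw`_m = 0 by apply/(leq_sizeP _ _ size_pw).
move: Ei Ej; rewrite pw0 !addr0 !mderivD !mderivM !mderivXU.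
rewrite eq_sym [i == j]eq_sym (negPf ji) !mul0r !add0r !mderivMn.
rewrite [(mlog m.+1)^`M(j)^`M(i)]mderiv_comm [(mlog m)^`M(j)^`M(i)]mderiv_comm => Ei Ej.
rewrite mulrBl mulrnBl -Ei -Ej; ring.
Qed.

End ElementarySeries.

(** * Graded ideals and regular sequences *)

Section GradedIdeals.
Variables (R : comNzRingType) (H : nat -> R -> Prop).
Hypothesis H0 : forall w, H w 0.
Hypothesis H1 : H 0 1.
Hypothesis HB : forall w a b, H w a -> H w b -> H w (a - b).
Hypothesis HM : forall v w a b, H v a -> H w b -> H (v + w) (a * b).
Implicit Types (I J : nat -> R -> Prop) (v w e f : nat) (a b c x y : R).
Implicit Type s : seq (nat * R).

Lemma gradedN w a : H w a -> H w (- a).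
Proof. by move=> h; rewrite -sub0r; apply: HB. Qed.

Lemma gradedD w a b : H w a -> H w b -> H w (a + b).
Proof. by move=> ha hb; rewrite -[b]opprK; apply/HB/gradedN. Qed.

Definition gideal I :=
  [/\ forall w a, I w a -> H w a, forall w, I w 0,
      forall w a b, I w a -> I w b -> I w (a - b)
    & forall v w x a, H v x -> I w a -> I (v + w)%N (x * a)].

Definition ieq I J := forall w a, I w a <-> J w a.

Lemma gidealN I w a : gideal I -> I w a -> I w (- a).
Proof. by case=> _ I0 IB _ h; rewrite -sub0r; apply: IB. Qed.

Lemma gidealD I w a b : gideal I -> I w a -> I w b -> I w (a + b).
Proof.
by move=> gI ha hb; rewrite -[b]opprK; case: (gI) => _ _ IB _; apply: IB => //; apply: gidealN.
Qed.

(** The elements of degree w - e, which are 0 if w < e. *)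
Definition shifted w e b := if (e <= w)%N then H (w - e) b else b = 0.

Lemma shifted0 w e : shifted w e 0.
Proof. by rewrite /shifted; case: ifP. Qed.

Lemma shiftedB w e a b : shifted w e a -> shifted w e b -> shifted w e (a - b).
Proof. by rewrite /shifted; case: ifP => _; [apply: HB | move=> -> ->; rewrite subrr]. Qed.

Lemma shiftedM v w e x b : H v x -> shifted w e b -> shifted (v + w) e (x * b).
Proof.
move=> hx; rewrite /shifted; case: leqP => [le hb|_ ->].
  by rewrite (leq_trans le (leq_addl _ _)) -addnBA //; apply: HM.
by case: ifP => _; rewrite mulr0.
Qed.

Lemma shifted_mul w e x b : H e x -> shifted w e b -> H w (x * b).
Proof.
move=> hx; rewrite /shifted; case: leqP => [le hb|_ ->]; last by rewrite mulr0.
by rewrite -(subnKC le); apply: HM.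
Qed.

(** The degree w part of the ideal generated by I and by x of degree e. *)
Definition adj I e x w a :=
  exists c b, [/\ I w c, shifted w e b & a = c + x * b].

Lemma adj_gideal I e x : H e x -> gideal I -> gideal (adj I e x).
Proof.
move=> hx gI; have [IH I0 IB IM] := gI; split.
- by move=> w _ [c [b [Ic hb ->]]]; apply/gradedD; [apply: IH | apply: shifted_mul hb].
- by move=> w; exists 0, 0; split; [| exact: shifted0 | rewrite mulr0 addr0].
- move=> w _ _ [c [b [Ic hb ->]]] [c' [b' [Ic' hb' ->]]].
  exists (c - c'), (b - b'); split; [exact: IB | exact: shiftedB | ring].
move=> v w y _ hy [c [b [Ic hb ->]]]; exists (y * c), (y * b).
by split; [exact: IM | exact: shiftedM | ring].
Qed.

Lemma adj_sub I e x w a : I w a -> adj I e x w a.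
Proof. by move=> Ia; exists a, 0; split=> //; [exact: shifted0 | rewrite mulr0 addr0]. Qed.

Lemma adj_mul I e x w b : gideal I -> shifted w e b -> adj I e x w (x * b).
Proof. by case=> _ I0 _ _ hb; exists 0, b; rewrite add0r. Qed.

Lemma adj_ieq I J e x : ieq I J -> ieq (adj I e x) (adj J e x).
Proof. by move=> E w a; split=> -[c [b [/E Ic hb ->]]]; exists c, b. Qed.

Lemma adjC I e x f y : ieq (adj (adj I e x) f y) (adj (adj I f y) e x).
Proof.
move=> w a; split=> -[_ [b [[c [b' [Ic hb' ->]]] hb ->]]].
  by exists (c + y * b), b'; split=> //; [exists c, b | ring].
by exists (c + x * b), b'; split=> //; [exists c, b | ring].
Qed.

(** Multiplication by x, of degree e, is injective modulo I on each degree. *)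
Definition NZD I e x := forall v a, H v a -> I (v + e)%N (x * a) -> I v a.

Lemma NZD_ieq I J e x : ieq I J -> NZD I e x -> NZD J e x.
Proof. by move=> E nz v a ha /E; move/(nz _ _ ha)/E. Qed.

(** Half of the symmetry of regular sequences; the other half, NZD_lift, uses
    that the degrees are positive. *)
Lemma NZD_swap I e x f y : gideal I -> H e x -> H f y ->
  NZD I e x -> NZD (adj I e x) f y -> NZD (adj I f y) e x.
Proof.
move=> gI hx hy nx ny v a ha [c [b [Ic hb E]]]; have [IH I0 IB IM] := gI.
move: hb; rewrite {1}/shifted; case: leqP => [le hb|_ b0]; last first.
  move: E; rewrite b0 mulr0 addr0 => E.
  by apply: adj_sub; apply: nx => //; rewrite E.
have : adj I e x (v + e - f) b.
  apply: ny => //; rewrite subnK //; exists (- c), a; split.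
  - exact: gidealN.
  - by rewrite /shifted leq_addl addnK.
  - by rewrite E; ring.
move=> [c' [b' [Ic' hb' Eb]]].
have hb2 : shifted v f b'.
  move: hb'; rewrite /shifted leq_subRL // [(f + e)%N]addnC -{1}(addnC e) leq_add2l.
  by case: ifP => // _; rewrite subnAC addnK.
exists (a - y * b'), b'; split=> //; last by ring.
apply: nx; first by apply: HB => //; exact: shifted_mul hb2.
rewrite (_ : _ * _ = c + y * c'); last by rewrite mulrBr E Eb; ring.
apply: gidealD => //; rewrite -(subnKC le); exact: IM.
Qed.

(** A homogeneous a with y a in I lies in I + x R, say a = c + x b, and b has
    the same property in a smaller degree. *)
Lemma NZD_lift I e x f y : gideal I -> H e x -> H f y -> (0 < e)%N ->
  NZD I e x -> NZD (adj I e x) f y -> NZD I f y.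
Proof.
move=> gI hx hy e0 nx ny v; have [IH I0 IB IM] := gI.
have [m] := ubnP v; elim: m v => // m IHm v lt a ha Iya.
have [c [b [Ic hb E]]] := ny v a ha (adj_sub e x Iya).
move: hb; rewrite /shifted; case: leqP => [le hb|_ b0]; last first.
  by rewrite E b0 mulr0 addr0.
rewrite E; apply: gidealD => //; rewrite -(subnKC le); apply: (IM) => //.
apply: (IHm) => //; first by lia.
apply: nx; first by rewrite addnC; exact: HM.
rewrite (_ : _ * _ = y * a - y * c); last by rewrite E; ring.
rewrite (_ : v - e + f + e = v + f)%N; last by lia.
by apply: IB => //; rewrite addnC; apply: (IM).
Qed.

Definition ext I s := foldl (fun J p => adj J p.1 p.2) I s.

Fixpoint reg I s := if s is p :: s' then NZD I p.1 p.2 /\ reg (adj I p.1 p.2) s' else True.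

Definition homs s := forall p, p \in s -> H p.1 p.2.

Lemma ext_ieq I J s : ieq I J -> ieq (ext I s) (ext J s).
Proof. by elim: s I J => //= p s IHs I J E; apply/IHs/adj_ieq. Qed.

Lemma ieq_sym I J : ieq I J -> ieq J I.
Proof. by move=> E w a; rewrite E. Qed.

Lemma ieq_trans I J K : ieq I J -> ieq J K -> ieq I K.
Proof. by move=> E E' w a; rewrite E. Qed.

Lemma reg_ieq I J s : ieq I J -> reg I s -> reg J s.
Proof.
by elim: s I J => //= p s IHs I J E [nz /(IHs _ _ (adj_ieq _ _ E))]; split=> //; apply: NZD_ieq nz.
Qed.

Lemma ext_adj I e x s : ieq (ext (adj I e x) s) (adj (ext I s) e x).
Proof.
elim: s I => [|p s IHs] I //=.
by apply: ieq_trans (IHs _); apply/ext_ieq/adjC.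
Qed.

Lemma ext_gideal I s : gideal I -> homs s -> gideal (ext I s).
Proof.
elim: s I => //= p s IHs I gI hs; apply: IHs; last by move=> q qs; apply: hs; rewrite inE qs orbT.
by apply: adj_gideal => //; apply: hs; rewrite mem_head.
Qed.

Lemma ext_sub I s w a : I w a -> ext I s w a.
Proof. by elim: s I => //= p s IHs I Ia; apply/IHs/adj_sub. Qed.

Lemma ext_mem I s p w b : gideal I -> homs s -> p \in s -> shifted w p.1 b ->
  ext I s w (p.2 * b).
Proof.
elim: s I => //= q s IHs I gI hs; rewrite inE => /orP[/eqP ->|ps] hb.
  by apply/ext_sub/adj_mul.
apply: IHs => //; last by move=> r rs; apply: hs; rewrite inE rs orbT.
by apply: adj_gideal => //; apply: hs; rewrite mem_head.
Qed.

Lemma ext_rcons I s p : ext I (rcons s p) = adj (ext I s) p.1 p.2.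
Proof. by rewrite /ext -cats1 foldl_cat. Qed.

Lemma reg_rcons I s p : reg I s -> NZD (ext I s) p.1 p.2 -> reg I (rcons s p).
Proof. by elim: s I => //= q s IHs I [nz rs] nzp; split=> //; apply: IHs. Qed.

(** NZD_swap and NZD_lift move x past the elements of s one by one. *)
Lemma reg_permute I e x s : gideal I -> H e x -> (0 < e)%N -> homs s ->
  NZD I e x -> reg (adj I e x) s -> reg I s /\ NZD (ext I s) e x.
Proof.
move=> + hx e0; elim: s I => [|p s IHs] I gI hs nx //= [np rs].
have hp : H p.1 p.2 by apply: hs; rewrite mem_head.
have [//||||rs' nx'] := IHs (adj I p.1 p.2).
- exact: adj_gideal.
- by move=> q qs; apply: hs; rewrite inE qs orbT.
- exact: NZD_swap.
- by apply: reg_ieq rs; apply: adjC.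
by do 2?split=> //; apply: NZD_lift nx np.
Qed.

Lemma graded_exp e x m : H e x -> H (m * e) (x ^+ m).
Proof.
by move=> hx; elim: m => [|m IHm]; rewrite ?expr0 // exprS mulSn; apply: HM.
Qed.

Lemma NZD_exp I e x m : H e x -> NZD I e x -> NZD I (m * e) (x ^+ m).
Proof.
move=> hx nx; elim: m => [|m IHm] v a ha; first by rewrite expr0 mul1r addn0.
rewrite exprS -mulrA mulSn addnCA addnC => Ia.
apply: IHm => //; apply: nx => //.
by rewrite addnC; apply: HM => //; apply: graded_exp.
Qed.

Lemma NZD_mul I e x f y : gideal I -> H e x -> H f y -> NZD I e x -> NZD I f y ->
  NZD I (e + f) (x * y).
Proof.
move=> gI hx hy nx ny v a ha; rewrite -mulrA [(e + f)%N]addnC addnA => Ia.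
by apply: ny => //; apply: nx => //; rewrite addnC; apply: HM.
Qed.

End GradedIdeals.

(** * Elementary symmetric polynomials as variables *)

Section PolyTop.
Variable S : comNzRingType.
Implicit Types p q : {poly S}.

Lemma coefM_top p q a b : (size p <= a.+1)%N -> (size q <= b.+1)%N ->
  (p * q)`_(a + b) = p`_a * q`_b.
Proof.
move=> /leq_sizeP sp /leq_sizeP sq; rewrite coefM.
have lt : (a < (a + b).+1)%N by lia.
rewrite (bigD1 (Ordinal lt)) //= addKn big1 ?addr0 // => j.
rewrite -val_eqE neq_ltn /= => /orP[lj|lj].
  by rewrite (sq (a + b - j)%N) ?mulr0 //; lia.
by rewrite sp ?mul0r.
Qed.

Lemma size_exp_bound p a m : (size p <= a.+1)%N -> (size (p ^+ m) <= (m * a).+1)%N.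
Proof.
move=> sp; elim: m => [|m IH]; first by rewrite expr0 size_poly1.
by rewrite exprS; apply: leq_trans (size_polyMleq _ _) _; lia.
Qed.

Lemma coef_exp_top p a m : (size p <= a.+1)%N -> (p ^+ m)`_(m * a) = p`_a ^+ m.
Proof.
move=> sp; elim: m => [|m IH]; first by rewrite !expr0 coef1.
by rewrite !exprS mulSn coefM_top ?IH //; apply: size_exp_bound.
Qed.

End PolyTop.

(** Symmetric polynomials are polynomials in e_1, ..., e_n, which become the
    variables of {mpoly F[n]}; here are e_j, (e^k)_m and M_m in these variables. *)
HB.lock Definition e_gen (F : numFieldType) n j : {mpoly F[n]} := symf (mesym n F j).
HB.lock Definition pw_gen (F : numFieldType) n k m : {mpoly F[n]} := symf (pw F n k)`_m.
HB.lock Definition log_gen (F : numFieldType) n k m : {mpoly F[n]} := symf (mlog F n k m).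

Section Lifts.
Variables (F : numFieldType) (n k : nat).
Local Notation R := {mpoly F[n]}.
Local Notation S := [tuple mesym n F i.+1 | i < n].

Definition whomog w (a : R) : Prop := a \is w.-homog for (mnmwgt (n := n)).

Lemma whomog0 w : whomog w 0. Proof. exact: dhomog0. Qed.
Lemma whomog1 : whomog 0 1. Proof. exact: dhomog1. Qed.
Lemma whomogB w a b : whomog w a -> whomog w b -> whomog w (a - b).
Proof. by move=> ha hb; rewrite /whomog rpredB. Qed.
Lemma whomogM v w a b : whomog v a -> whomog w b -> whomog (v + w) (a * b).
Proof. exact: dhomogM. Qed.
Lemma whomogZ w (c : F) a : whomog w a -> whomog w (c *: a).
Proof. by move=> ha; rewrite /whomog rpredZ. Qed.

Local Notation e_gen := (e_gen F n).
Local Notation pw_gen := (pw_gen F n k).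
Local Notation log_gen := (log_gen F n k).

Lemma symfK (p : R) : p \is symmetric -> symf p \mPo S = p.
Proof. by move/symfP <-. Qed.

Lemma symf_homog d (p : R) : p \is symmetric -> p \is d.-homog -> whomog d (symf p).
Proof. by move=> sp hp; rewrite /whomog mwmwgt_homogE symfK. Qed.

Lemma e_genK j : e_gen j \mPo S = mesym n F j. Proof. by rewrite e_gen.unlock symfK // mesym_sym. Qed.
Lemma pw_genK m : pw_gen m \mPo S = (pw F n k)`_m. Proof. by rewrite pw_gen.unlock symfK // pw_sym. Qed.
Lemma log_genK m : log_gen m \mPo S = mlog F n k m. Proof. by rewrite log_gen.unlock symfK // mlog_sym. Qed.

Lemma whomog_e j : whomog j (e_gen j).
Proof. by rewrite e_gen.unlock; apply: symf_homog; [exact: mesym_sym | exact: dhomog_mesym]. Qed.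
Lemma whomog_g m : whomog m (pw_gen m).
Proof. by rewrite pw_gen.unlock; apply: symf_homog; [exact: pw_sym | exact: graded_pw]. Qed.
Lemma whomog_m m : whomog m (log_gen m).
Proof. by rewrite log_gen.unlock; apply: symf_homog; [exact: mlog_sym | exact: mlog_homog]. Qed.

Lemma e_genX (i : 'I_n) : e_gen i.+1 = 'X_i.
Proof.
apply: msym_fundamental_un; rewrite e_genK comp_mpolyXU -tnth_nth tnth_mktuple.
by [].
Qed.

Lemma e_gen0 : e_gen 0 = 1.
Proof. by apply: msym_fundamental_un; rewrite e_genK mesym0E comp_mpoly1. Qed.

Lemma e_gen_gt j : (n < j)%N -> e_gen j = 0.
Proof. by move=> nj; apply: msym_fundamental_un; rewrite e_genK mesym_geqnE // comp_mpoly0. Qed.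

Lemma pw_gen_coef m : pw_gen m = ((\poly_(j < n.+1) e_gen j) ^+ k)`_m.
Proof.
apply: msym_fundamental_un; rewrite pw_genK -coef_map rmorphXn /=.
rewrite (_ : map_poly _ _ = gen_elem F n) //; apply/esym/polyP => j; rewrite coef_gen_elem coef_map coef_poly /= ltnS.
by case: leqP => [_|nj]; rewrite ?e_genK // comp_mpoly0 mesym_geqnE.
Qed.

(** The terms with index j of the recursion mlog_rec, solved for its leading
    term. *)
Definition rec_term w j : R :=
  (e_gen j * log_gen (w - j)) *+ (k * j) + (e_gen j * pw_gen (w - j)) *+ j - (e_gen j * log_gen (w - j)) *+ (w - j).

Lemma log_gen_rec m : log_gen m.+1 *+ m.+1 = \sum_(j < m.+1) rec_term m.+1 j.+1.
Proof.
rewrite /rec_term; under eq_bigr do rewrite subSS.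
rewrite sumrB big_split /= [X in _ - X]big_ord_recr /= subnn mulr0n addr0.
apply/eqP; rewrite eq_sym subr_eq; apply/eqP.
transitivity (\sum_(j < m.+1) (e_gen j * log_gen (m - j).+1) *+ (m - j).+1); last first.
  rewrite big_ord_recl /= e_gen0 mul1r subn0; congr (_ + _); apply: eq_bigr => j _.
  by rewrite /= /bump /= add1n -subSn // subSS.
apply: msym_fundamental_un; rewrite raddfD !raddf_sum /=; apply/esym.
under eq_bigr => j _ do rewrite raddfMn /= rmorphM /= e_genK log_genK.
rewrite mlog_rec; congr (_ + _); apply: eq_bigr => j _.
  by rewrite raddfMn /= rmorphM /= e_genK log_genK.
by rewrite raddfMn /= rmorphM /= e_genK pw_genK.
Qed.

(** Setting e_(i+1), ..., e_n to zero; the variable 'X_j stands for e_(j+1). *)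
Definition rho i : R -> R := comp_mpoly [tuple if (j < i)%N then 'X_j else 0 | j < n].

HB.instance Definition _ i := GRing.RMorphism.on (rho i).
HB.instance Definition _ i := GRing.Linear.on (rho i).

Lemma rhoX i (j : 'I_n) : rho i 'X_j = if (j < i)%N then 'X_j else 0.
Proof. by rewrite /rho comp_mpolyXU -tnth_nth tnth_mktuple. Qed.

Lemma rho_e i j : rho i (e_gen j) = if (j <= i)%N then e_gen j else 0.
Proof.
case: j => [|j]; first by rewrite e_gen0 rmorph1.
have [jn|nj] := ltnP j n; last by rewrite e_gen_gt // raddf0 if_same.
by rewrite (e_genX (Ordinal jn)) rhoX.
Qed.

(** If only e_1, ..., e_i are nonzero, then e(t)^k has degree at most k i. *)
Lemma rho_g_gt i m : (k * i < m)%N -> rho i (pw_gen m) = 0.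
Proof.
move=> im; rewrite pw_gen_coef -coef_map rmorphXn /=.
apply/(leq_sizeP _ (k * i).+1) => //; apply: size_exp_bound.
apply/leq_sizeP => j ij; rewrite coef_map coef_poly /=.
by case: ifP => _; rewrite ?raddf0 // rho_e leqNgt ij.
Qed.

Lemma rho_g_top i : (i <= n)%N -> rho i (pw_gen (k * i)) = rho i (e_gen i ^+ k).
Proof.
move=> le; rewrite pw_gen_coef -coef_map rmorphXn /= coef_exp_top.
  by rewrite coef_map coef_poly ltnS le /= rmorphXn.
apply/leq_sizeP => j ij; rewrite coef_map coef_poly /=.
by case: ifP => _; rewrite ?raddf0 // rho_e leqNgt ij.
Qed.

Lemma rho_n a : rho n a = a.
Proof.
rewrite /rho -[RHS]comp_mpoly_id; congr comp_mpoly.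
by apply: eq_from_tnth => j; rewrite !tnth_mktuple ltn_ord.
Qed.

Lemma rho_rho i a : rho i (rho i.+1 a) = rho i a.
Proof.
elim/mpoly_indX: a => [||p q IH IH'|c p IH|j p IH].
- by rewrite !raddf0.
- by rewrite !rmorph1.
- by rewrite !raddfD /= IH IH'.
- by rewrite !linearZ /= IH.
rewrite !rmorphM /= IH rhoX; congr (_ * _).
rewrite rhoX; case: (ltnP j i.+1) => lt; first by rewrite rhoX.
by rewrite raddf0 ltnNge ltnW.
Qed.

Definition ker_rho i w (a : R) : Prop := whomog w a /\ rho i a = 0.

Lemma ker_rho_gideal i : gideal whomog (ker_rho i).
Proof.
split=> [w a []//|w|w a b [ha ra] [hb rb]|v w x a hx [ha ra]].
- by split; [exact: whomog0 | exact: raddf0].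
- by split; [exact: whomogB | rewrite raddfB /= ra rb subrr].
- by split; [exact: whomogM | rewrite rmorphM /= ra mulr0].
Qed.

Lemma ker_rho_NZD i e x : rho i x != 0 -> NZD whomog (ker_rho i) e x.
Proof.
move=> nz v a ha [_]; rewrite rmorphM /= => /eqP.
by rewrite mulf_eq0 (negPf nz) => /eqP.
Qed.

Lemma ker_rho_NZD_e i : (i < n)%N -> NZD whomog (ker_rho i.+1) i.+1 (e_gen i.+1).
Proof.
move=> lt; apply: ker_rho_NZD; rewrite rho_e leqnn (e_genX (Ordinal lt)).
by apply/eqP => /(congr1 (mcoeff U_(Ordinal lt))) /eqP; rewrite mcoeffXU eqxx mcoeff0 oner_eq0.
Qed.

(** Setting e_(i+1) to zero as well: subtract from a the monomials that
    contain e_(i+1). *)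
Lemma ker_rho_adj i : (i < n)%N -> ieq (adj whomog (ker_rho i.+1) i.+1 (e_gen i.+1)) (ker_rho i).
Proof.
move=> lt w a; pose o := Ordinal lt; split=> [[c [b [[hc rc] hb ->]]]|[ha ra]].
  split; first by apply: (gradedD whomog0 whomogB) => //; apply: (shifted_mul whomog0 whomogM (whomog_e _) hb).
  by rewrite raddfD /= rmorphM /= -rho_rho rc raddf0 rho_e ltnn mul0r addr0.
suff [b hb E] : exists2 b, shifted whomog w i.+1 b & rho i.+1 (a - e_gen i.+1 * b) = rho i a.
  exists (a - e_gen i.+1 * b), b; split=> //; last by rewrite subrK.
  split; last by rewrite E ra.
  by apply: whomogB => //; apply: (shifted_mul whomog0 whomogM (whomog_e _) hb).
rewrite (e_genX o) [a]mpolyE big_seq.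
apply: (big_ind (fun p => exists2 b, shifted whomog w i.+1 b & rho i.+1 (p - 'X_o * b) = rho i p)).
- by exists 0; [exact: (shifted0 whomog0) | rewrite mulr0 subr0 !raddf0].
- move=> p q [b hb E] [c hc E']; exists (b - - c).
    apply: (shiftedB whomogB) => //; rewrite -sub0r; apply: (shiftedB whomogB) => //; exact: (shifted0 whomog0).
  by rewrite opprK mulrDr opprD addrACA (raddfD (rho i.+1)) /= E E' raddfD.
move=> m ma; have wm : mnmwgt m = w by have := dhomog_mf ha ma.
have [m0|mi] := eqVneq (m o) 0%N.
  exists 0; first exact: (shifted0 whomog0).
  rewrite mulr0 subr0 !linearZ /=; congr (_ *: _).
  rewrite mpolyXE_id !rmorph_prod /=; apply: eq_bigr => j _.
  rewrite !rmorphXn /= !rhoX ltnS leq_eqVlt; case: eqP => //= ji.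
  by rewrite (_ : j = o) ?m0 ?expr0 //; apply: val_inj.
exists (a@_m *: 'X_[m - U_(o)]).
  have E := mnmwgtD (m - U_(o)) U_(o); move: E.
  rewrite submK ?lep1mP // wm mnmwgt1 /= => ->; rewrite /shifted leq_addl addnK.
  by apply: whomogZ; rewrite /whomog dhomogX.
rewrite -scalerAr -mpolyX_U // subrr raddf0 linearZ /= (mpolyX_U _ mi) rmorphM /= rhoX ltnn.
by rewrite mul0r scaler0.
Qed.

End Lifts.

(** * The logarithmic coefficients form a regular sequence *)

Section LogSequence.
Variables (F : numFieldType) (n k : nat).
Local Notation R := {mpoly F[n]}.
Local Notation whomog := (@whomog F n).
Local Notation e_gen := (e_gen F n).
Local Notation pw_gen := (pw_gen F n k).
Local Notation log_gen := (log_gen F n k).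
Local Notation ker_rho := (@ker_rho F n).
Local Notation rho := (@rho F n).
Local Notation whomog0 := (@whomog0 F n).
Local Notation whomogB := (@whomogB F n).
Local Notation whomogM := (@whomogM F n).
Local Notation gideal := (gideal whomog).
Local Notation adj := (adj whomog).
Local Notation ext := (ext whomog).
Local Notation reg := (reg whomog).
Local Notation NZD := (NZD whomog).
Implicit Types (I : nat -> R -> Prop) (a b c x y : R).

Lemma whomog_C (c : F) : whomog 0 c%:MP. Proof. by rewrite -alg_mpolyC; apply/whomogZ/whomog1. Qed.

Lemma gidealZ I w (c : F) a : gideal I -> I w a -> I w (c *: a).
Proof. by case=> _ _ _ IM Ia; rewrite -mul_mpolyC; apply: (IM 0%N) => //; apply: whomog_C. Qed.

Lemma gidealMn I w a m : gideal I -> I w a -> I w (a *+ m).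
Proof. by move=> gI; rewrite -scaler_nat; apply: gidealZ. Qed.

Lemma gideal_shifted I w e a b : gideal I -> I e a -> shifted whomog w e b -> I w (a * b).
Proof.
move=> [_ I0 _ IM] Ia; rewrite /shifted; case: leqP => [le hb|_ ->]; last by rewrite mulr0.
by rewrite mulrC -(subnK le); apply: IM.
Qed.

Lemma adj_le I e x y (c : F) w a : gideal I -> I e (x - c *: y) -> adj I e x w a -> adj I e y w a.
Proof.
move=> gI Id [d [b [Id' hb ->]]]; exists (d + (x - c *: y) * b), (c%:MP * b); split.
- by apply: (gidealD gI) => //; exact: gideal_shifted gI Id hb.
- by have := shiftedM whomog0 whomogM (whomog_C c) hb; rewrite add0n.
- by rewrite -mul_mpolyC; ring.
Qed.

Lemma adj_associate I e x y (c : F) : gideal I -> c != 0 -> I e (x - c *: y) ->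
  ieq (adj I e x) (adj I e y).
Proof.
move=> gI c0 Id w a; split; first exact: adj_le Id.
apply: (@adj_le _ _ _ _ c^-1) => //.
rewrite (_ : _ - _ = (- c^-1) *: (x - c *: y)); last first.
  by rewrite scalerBr !scaleNr scalerA mulVf // scale1r opprK addrC.
exact: gidealZ.
Qed.

Lemma NZD_associate I e x y (c : F) : gideal I -> c != 0 -> I e (x - c *: y) -> NZD I e y -> NZD I e x.
Proof.
move=> gI c0 Id ny v a ha Ia; apply: ny => //.
rewrite (_ : y * a = c^-1 *: (x * a - a * (x - c *: y))).
  case: (gI) => _ _ IB IM; apply: gidealZ => //; apply: IB => //.
  exact: IM.
rewrite (_ : x * a - _ = (c *: y) * a); last by ring.
by rewrite -scalerAl scalerA mulVf // scale1r.
Qed.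

(** M_(N+1), ..., M_(N+i). *)
Definition log_seq N i := [seq (m, log_gen m) | m <- iota N.+1 i].

(** The ideals of M_(N+1), ..., M_(N+i-1) and of M_(N+1), ..., M_(N+i) modulo
    e_(i+1), ..., e_n. *)
Definition pre_ideal i N := ext (ker_rho i) (log_seq N i.-1).
Definition log_ideal i N := ext (ker_rho i) (log_seq N i).

Lemma homs_log_seq N i : homs whomog (log_seq N i).
Proof. by move=> p /mapP[m _ ->]; apply: whomog_m. Qed.

Lemma pre_ideal_gideal i N : gideal (pre_ideal i N).
Proof. exact/(ext_gideal whomog0 whomogB whomogM)/homs_log_seq/ker_rho_gideal. Qed.

Lemma log_ideal_gideal i N : gideal (log_ideal i N).
Proof. exact/(ext_gideal whomog0 whomogB whomogM)/homs_log_seq/ker_rho_gideal. Qed.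

(** By log_relation, M_(N+i) is e_i times this element modulo pre_ideal i N, up
    to a nonzero scalar. *)
Definition cofactor i N := if N == (k * i)%N then e_gen i ^+ k else log_gen N.

Lemma whomog_cofactor i N : whomog N (cofactor i N).
Proof.
rewrite /cofactor; case: eqP => [->|_]; last exact: whomog_m.
exact: (graded_exp (@whomog1 F n) whomogM k (whomog_e F n i)).
Qed.

(** For j < i the recursion only involves the generators M_(N+i-j) and the
    coefficients (e^k)_(N+i-j), which vanish as N + i - j > k i; for j > i all
    terms contain e_j, which is zero. *)
Lemma rec_term_pre_ideal i N j : (0 < j <= N + i)%N -> (k * i <= N)%N -> j != i ->
  pre_ideal i N (N + i) (rec_term F n k (N + i) j).
Proof.
move=> /andP[j0 jN] kN ji; have gI := pre_ideal_gideal i N; have [IH I0 IB IM] := gI.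
have IV w a : ker_rho i w a -> pre_ideal i N w a by move=> h; exact: (ext_sub whomog0 _ h).
have hp b : whomog (N + i - j) b -> whomog (N + i) (e_gen j * b).
  by move=> hb; rewrite -(subnKC jN); apply: whomogM => //; apply: whomog_e.
rewrite /rec_term; case: (ltngtP j i) ji => // [lt|gt] _.
  have Ie : pre_ideal i N (N + i) (e_gen j * log_gen (N + i - j)).
    rewrite mulrC.
    apply: (@ext_mem _ _ whomog0 whomogB whomogM _ _ (N + i - j, log_gen (N + i - j))%N) => /=.
    - exact: ker_rho_gideal.
    - exact: homs_log_seq.
    - by apply/mapP; exists (N + i - j)%N => //; rewrite mem_iota; lia.
    - by rewrite /shifted leq_subr subKn //; apply: whomog_e.
  apply: (IB); first apply: (gidealD gI) => //; apply: gidealMn => //.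
  apply: IV; split; first by apply: hp; apply: whomog_g.
  by rewrite rmorphM /= rho_g_gt ?mulr0 //; lia.
have IVe b : whomog (N + i - j) b -> pre_ideal i N (N + i) (e_gen j * b).
  move=> hb; apply: IV; split; first exact: hp.
  by rewrite rmorphM /= rho_e leqNgt gt mul0r.
apply: (IB); first apply: (gidealD gI) => //; apply: gidealMn => //; apply: IVe.
- exact: whomog_m.
- exact: whomog_g.
- exact: whomog_m.
Qed.

(** The term j = i of the recursion is what remains. If N = k i, the
    coefficients of e_i M_N cancel and (e^k)_N = e_i^k; if N > k i, then
    (e^k)_N = 0 and e_i M_N has the coefficient k i - N. *)
Lemma log_relation i N : (0 < i <= n)%N -> (k * i <= N)%N ->
  exists2 c : F, c != 0 & pre_ideal i N (N + i) (log_gen (N + i) - c *: (e_gen i * cofactor i N)).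
Proof.
move=> /andP[i0 lei] kN; have gI := pre_ideal_gideal i N; have [IH I0 IB IM] := gI.
have IV w a : ker_rho i w a -> pre_ideal i N w a by move=> h; exact: (ext_sub whomog0 _ h).
pose w := (N + i)%N; have w0 : (0 < w)%N by rewrite /w; lia.
have wF : w%:R != 0 :> F by rewrite pnatr_eq0; lia.
suff [c c0 Ic] : exists2 c : F, c != 0 & pre_ideal i N w (rec_term F n k w i - c *: (e_gen i * cofactor i N)).
  exists (w%:R^-1 * c); first by rewrite mulf_neq0 // invr_eq0.
  rewrite (_ : _ - _ = w%:R^-1 *: (log_gen w *+ w - c *: (e_gen i * cofactor i N))); last first.
    by rewrite scalerBr scalerA -[log_gen w *+ w]scaler_nat scalerA mulVf // scale1r.
  apply: gidealZ => //.
  have := log_gen_rec F n k w.-1; rewrite prednK // => ->.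
  have lt : (i.-1 < w)%N by rewrite /w; lia.
  rewrite (bigD1 (Ordinal lt)) //= prednK // addrAC.
  apply: (gidealD gI) => //.
  apply: big_ind => //; first by move=> a b; apply: (gidealD gI).
  move=> j; rewrite -val_eqE /= => ji.
  by apply: rec_term_pre_ideal => //; [have := ltn_ord j; rewrite /w; lia | lia].
rewrite /rec_term /w addnK /cofactor; case: eqP => [Nki|/eqP kiN].
  rewrite {}Nki in gI IH I0 IB IM IV *.
  exists i%:R; first by rewrite pnatr_eq0; lia.
  rewrite [X in X - _]addrAC subrr add0r scaler_nat -mulrnBl -mulrBr.
  apply: gidealMn => //; apply: IV; split; last first.
    by rewrite rmorphM rmorphB /= rho_g_top // subrr mulr0.
  rewrite addnC; apply: whomogM; first exact: whomog_e.
  apply: whomogB; first exact: whomog_g.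
  exact: (graded_exp (@whomog1 F n) whomogM k (whomog_e F n i)).
exists (- (N - k * i)%:R); first by rewrite oppr_eq0 pnatr_eq0; lia.
rewrite scaleNr opprK scaler_nat mulrnBr // (_ : _ - _ + _ = (e_gen i * pw_gen N) *+ i); last first.
  have gen (x y z : R) : x + y - z + (z - x) = y by ring.
  exact: gen.
apply: gidealMn => //; apply: IV; split.
  by rewrite addnC; apply: whomogM; [exact: whomog_e | exact: whomog_g].
by rewrite rmorphM /= rho_g_gt ?mulr0 //; lia.
Qed.

Lemma log_seq_rcons N i : log_seq N i.+1 = rcons (log_seq N i) ((N + i.+1)%N, log_gen (N + i.+1)).
Proof. by rewrite /log_seq -{1}(addn1 i) iotaD map_cat cats1 addSn addnS. Qed.

Lemma log_ideal_adj i N : (0 < i)%N -> log_ideal i N = adj (pre_ideal i N) (N + i) (log_gen (N + i)).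
Proof.
by case: i => // i _; rewrite /log_ideal log_seq_rcons ext_rcons.
Qed.

Lemma log_ideal_cofactor i N : (0 < i <= n)%N -> (k * i <= N)%N ->
  ieq (log_ideal i N) (adj (pre_ideal i N) (N + i) (e_gen i * cofactor i N)).
Proof.
move=> hi kN; have [c c0 Ic] := log_relation hi kN; rewrite log_ideal_adj; last by case/andP: hi.
exact: adj_associate (pre_ideal_gideal _ _) c0 Ic.
Qed.

Lemma pre_ideal_e i N : (i < n)%N -> ieq (adj (pre_ideal i.+1 N) i.+1 (e_gen i.+1)) (log_ideal i N).
Proof.
move=> lt; have E := ieq_sym (@ext_adj _ whomog (ker_rho i.+1) i.+1 (e_gen i.+1) (log_seq N i)).
have E2 := @ext_ieq _ whomog _ _ (log_seq N i) (ker_rho_adj lt).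
exact: (ieq_trans E E2).
Qed.

Lemma pre_ideal_log i N : ieq (adj (pre_ideal i.+1 N.+1) N.+1 (log_gen N.+1)) (log_ideal i.+1 N).
Proof. exact/ieq_sym/ext_adj. Qed.

(** Induction on i, then on N. Modulo e_i the sequence is regular by induction
    on i, so e_i is a nonzero divisor modulo M_(N+1), ..., M_(N+i-1). The cofactor
    is a power of e_i or M_N, and M_N, ..., M_(N+i-1) is regular by induction on
    N. So M_(N+i), which is associated to e_i times the cofactor, is a nonzero
    divisor. *)
Lemma log_seq_regular i N : (i <= n)%N -> (k * i <= N)%N ->
  [/\ reg (ker_rho i) (log_seq N i), (0 < i)%N -> NZD (pre_ideal i N) i (e_gen i)
    & (0 < i)%N -> NZD (pre_ideal i N) N (cofactor i N)].
Proof.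
elim: i N => [|i IHi] N lei kN; first by split.
elim/ltn_ind: N kN => N IHN kN.
have [rs _ _] := IHi N (ltnW lei) ltac:(lia).
have rs' : reg (adj (ker_rho i.+1) i.+1 (e_gen i.+1)) (log_seq N i).
  by apply: reg_ieq rs; apply/ieq_sym/ker_rho_adj.
have [r ne] := reg_permute whomog0 whomogB whomogM (@ker_rho_gideal F n i.+1) (whomog_e F n i.+1) isT (@homs_log_seq _ _)
  (@ker_rho_NZD_e F n i lei) rs'.
suff nu : NZD (pre_ideal i.+1 N) N (cofactor i.+1 N).
  split=> [|_|_]; [|exact: ne|exact: nu]; have [c c0 Ic] := @log_relation i.+1 N lei kN.
  rewrite log_seq_rcons; apply: reg_rcons => //; apply: NZD_associate c0 Ic _; first exact: pre_ideal_gideal.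
  by rewrite addnC; apply: (NZD_mul whomogM (pre_ideal_gideal _ _)) => //; [exact: whomog_e | exact: whomog_cofactor].
rewrite /cofactor; case: eqP => [E|/eqP kiN].
  by move: (@NZD_exp _ _ (@whomog1 F n) whomogM _ _ _ k (whomog_e F n i.+1) ne); rewrite -E.
case: N kN kiN {rs rs' r ne} IHN => [|N] kN kiN IHN; first by lia.
have [rN _ _] := IHN N (ltnSn N) ltac:(lia); have [nN rN'] := rN.
have [_ nN'] := reg_permute whomog0 whomogB whomogM (@ker_rho_gideal F n i.+1) (whomog_m F n k N.+1) isT (@homs_log_seq _ _) nN rN'.
exact: nN'.
Qed.

End LogSequence.

(** * The socle of the quotient *)

Section Socle.
Variables (F : numFieldType) (n k : nat).
Local Notation R := {mpoly F[n]}.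
Local Notation whomog := (@whomog F n).
Local Notation e_gen := (e_gen F n).
Local Notation log_gen := (log_gen F n k).
Local Notation ker_rho := (@ker_rho F n).
Local Notation rho := (@rho F n).
Local Notation whomog0 := (@whomog0 F n).
Local Notation whomogB := (@whomogB F n).
Local Notation whomogM := (@whomogM F n).
Local Notation adj := (adj whomog).
Local Notation pre_ideal := (@pre_ideal F n k).
Local Notation log_ideal := (@log_ideal F n k).
Local Notation cofactor := (@cofactor F n k).
Implicit Types (a b c x y : R).

Lemma ker_rho0_pos w a : whomog w a -> (0 < w)%N -> ker_rho 0 w a.
Proof.
move=> ha w0; split=> //; rewrite [a]mpolyE big_seq raddf_sum /= big1 // => m ma.
have wm : mnmwgt m = w by have := dhomog_mf ha ma.
rewrite linearZ /= mpolyXE_id rmorph_prod /=.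
suff [i mi] : exists i, m i != 0%N.
  by rewrite (bigD1 i) //= rmorphXn /= rhoX /= expr0n (negPf mi) mul0r scaler0.
have [/existsP//|/existsPn z] := boolP [exists i, m i != 0%N].
move: w0; rewrite -wm (_ : m = 0%MM) ?mnmwgt0 //.
by apply/mnmP => i; rewrite mnm0E; apply/eqP; rewrite -[_ == _]negbK.
Qed.

Lemma whomog0_const a : whomog 0 a -> a = (a@_0)%:MP.
Proof.
move=> ha; apply/mpolyP => m; rewrite mcoeffC.
case: (eqVneq 0%MM m) => [<-|m0]; first by rewrite mulr1.
rewrite mulr0; apply/eqP/negPn/negP; rewrite -mcoeff_msupp => ma.
have := dhomog_mf ha ma; move=> wm; have := leq_mdeg_mnmwgt m.
by rewrite wm leqn0 mdeg_eq0 eq_sym (negPf m0).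
Qed.

(** Write a = c + e_i b using the bound for i - 1; the degree of b exceeds
    (N - 1) i, so b is in the ideal of the cofactor: by induction on N if it is
    M_N, and by division by e_i, k more times, if it is e_i^k. *)
Lemma log_ideal_top i N v a : (i <= n)%N -> (k * i <= N)%N -> whomog v a -> (N * i < v)%N -> log_ideal i N v a.
Proof.
elim: i N v a => [|i IHi] N v a lei kN ha lt; first by rewrite muln0 in lt; apply: ker_rho0_pos.
elim/ltn_ind: N kN v a ha lt => N IHN kN v a ha lt.
have gI := @pre_ideal_gideal F n k i.+1 N : gideal whomog (pre_ideal i.+1 N).
have top_e w b : whomog w b -> (N * i < w)%N -> adj (pre_ideal i.+1 N) i.+1 (e_gen i.+1) w b.
  move=> hb lw; apply/(pre_ideal_e k N lei); apply: IHi => //; [exact: ltnW | lia].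
have step w m x b : whomog w b -> (N * i < w)%N ->
    (forall c, whomog (w - i.+1) c -> (i.+1 <= w)%N -> adj (pre_ideal i.+1 N) m x (w - i.+1) c) ->
    adj (pre_ideal i.+1 N) (i.+1 + m) (e_gen i.+1 * x) w b.
  move=> hb lw P; have [c [d [Ic hd ->]]] := top_e w b hb lw.
  move: hd; rewrite /shifted; case: (leqP i.+1 w) => [le hd|_ ->]; last first.
    by rewrite mulr0 addr0; exact: (adj_sub whomog0).
  have [c' [d' [Ic' hd' ->]]] := P d hd le.
  exists (c + e_gen i.+1 * c'), d'; split; last by ring.
    apply: (gidealD gI) => //; rewrite -(subnKC le).
    by case: gI => _ _ _ IM; apply: IM => //; apply: whomog_e.
  move: hd'; rewrite /shifted leq_subRL // subnDA; by [].
apply/(@log_ideal_cofactor F n k i.+1 N lei kN); rewrite addnC; apply: (step) => //; first by lia.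
move=> c hc lec; rewrite /cofactor; case: eqP => [E|/eqP kiN]; last first.
  case: N kN kiN IHN lt {top_e step gI} => [|N] kN kiN IHN lt; first by lia.
  by apply/(pre_ideal_log k i N); apply: IHN => //; lia.
suff P t w b : whomog w b -> (N * i + t * i.+1 < w + i.+1)%N ->
    adj (pre_ideal i.+1 N) (t * i.+1) (e_gen i.+1 ^+ t) w b.
  by have := P k _ _ hc; rewrite -E; apply; lia.
elim: t w b => [|t IHt] w b hb lw.
  rewrite expr0 mul0n -[b]mul1r; apply: (adj_mul 1 gI); rewrite /shifted subn0; exact: hb.
rewrite exprS mulSn; apply: (step) => //; first by lia.
by move=> c' hc' le; apply: IHt => //; lia.
Qed.

(** If e_i a is in pre_ideal + (e_i u), u the cofactor, then a = u b modulo
    pre_ideal, because e_i is a nonzero divisor. As u is one too, b is in the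
    socle for i - 1 and N. So u times the generator of the socle for i - 1
    generates the socle for i. *)
Lemma log_ideal_socle i N : (i <= n)%N -> (k * i <= N)%N -> exists2 s, whomog (N * i) s &
  forall v a, whomog v a -> (forall j, (0 < j <= i)%N -> log_ideal i N (v + j) (e_gen j * a)) ->
  log_ideal i N v a \/ v = (N * i)%N /\ exists c : F, log_ideal i N v (a - c *: s).
Proof.
elim: i => [|i IHi] lei kN.
  exists 1; first by rewrite muln0; apply: whomog1.
  move=> v a ha _; rewrite muln0; case: (posnP v) => [v0|vp]; last by left; apply: ker_rho0_pos.
  right; split=> //; exists a@_0; rewrite v0 in ha *; rewrite {1}(whomog0_const ha) alg_mpolyC subrr.
  by have [_ + _ _] := @log_ideal_gideal F n k 0 N; apply.
have gI := @pre_ideal_gideal F n k i.+1 N : gideal whomog (pre_ideal i.+1 N).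
have gJ := @log_ideal_gideal F n k i.+1 N : gideal whomog (log_ideal i.+1 N).
have [IH I0 IB IM] := gI.
have [s hs P] := IHi (ltnW lei) ltac:(lia).
have [_ ne nu] := @log_seq_regular F n k i.+1 N lei kN; have {}ne := ne isT; have {}nu := nu isT.
have JE := @log_ideal_cofactor F n k i.+1 N lei kN; have hu := @whomog_cofactor F n k i.+1 N : whomog N (cofactor i.+1 N).
have he := whomog_e F n i.+1.
exists (cofactor i.+1 N * s); first by rewrite mulnS; apply: whomogM.
move=> v a ha ea; have /JE[c [b [Ic hb Eb]]] := ea i.+1 (leqnn _).
move: hb; rewrite /shifted; case: (leqP (N + i.+1) (v + i.+1)) => [le hb|_ b0]; last first.
  left; apply/JE/(adj_sub whomog0)/ne => //; move: Eb; rewrite b0 mulr0 addr0 => -> //.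
have Nv : (N <= v)%N by lia.
have {}hb : whomog (v - N) b by move: hb; rewrite addnC [(N + _)%N]addnC subnDl.
have Ia : pre_ideal i.+1 N v (a - cofactor i.+1 N * b).
  apply: ne; first by apply: whomogB => //; rewrite -(subnKC Nv); apply: whomogM.
  by rewrite mulrBr Eb mulrA addrK.
have eb j : (0 < j <= i)%N -> log_ideal i N (v - N + j) (e_gen j * b).
  move=> /andP[j0 ji].
  have /JE[c' [b' [Ic' hb' Eb']]] := ea j ltac:(lia).
  apply/(pre_ideal_e k N lei).
  have Ij : pre_ideal i.+1 N (v - N + j + N) (cofactor i.+1 N * (e_gen j * b - e_gen i.+1 * b')).
    rewrite (_ : _ * _ = c' - e_gen j * (a - cofactor i.+1 N * b)); last first.
      by rewrite [e_gen j * (a - _)]mulrBr Eb'; ring.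
    rewrite (_ : (v - N + j + N)%N = (v + j)%N); last by lia.
    by apply: IB => //; rewrite addnC; apply: IM => //; apply: whomog_e.
  have hb2 : shifted whomog (v - N + j) i.+1 b'.
    move: hb'; rewrite /shifted (_ : (N + i.+1 <= v + j) = (i.+1 <= v - N + j))%N; last by lia.
    by case: ifP => // _; rewrite (_ : (v - N + j - i.+1 = v + j - (N + i.+1)))%N //; lia.
  exists (e_gen j * b - e_gen i.+1 * b'), b'; split=> //; last by rewrite subrK.
  apply: nu Ij; apply: whomogB; first by rewrite addnC; apply: whomogM => //; apply: whomog_e.
  exact: (shifted_mul whomog0 whomogM he hb2).
have up d : log_ideal i N (v - N) d -> log_ideal i.+1 N v (cofactor i.+1 N * d).
  move=> /(pre_ideal_e k N lei)[c' [b' [Ic' hb' ->]]]; apply/JE.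
  exists (cofactor i.+1 N * c'), b'; split; last by ring.
    by rewrite -(subnKC Nv); apply: IM.
  by move: hb'; rewrite /shifted leq_subRL // subnDA.
have Ja d : log_ideal i.+1 N v (cofactor i.+1 N * b - d) -> log_ideal i.+1 N v (a - d).
  move=> Jd; rewrite (_ : a - d = (a - cofactor i.+1 N * b) + (cofactor i.+1 N * b - d)); last by ring.
  by apply: (gidealD gJ) => //; apply/JE/(adj_sub whomog0).
have [Jb|[vN [l Jl]]] := P _ b hb eb.
  by left; rewrite -[a]subr0; apply: Ja; rewrite subr0; apply: up.
right; split; first by lia.
exists l; apply: Ja; rewrite (_ : _ - _ = cofactor i.+1 N * (b - l *: s)); first exact: up.
by rewrite mulrBr scalerAr.
Qed.

(** Descending induction on the degree of r: all e_j r are in the ideal, so r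
    is in the socle, where psi is injective. That psi is nonzero on the socle is
    tested on e_1^(N n), which lies in it for reasons of degree. *)
Lemma log_ideal_nondegenerate N (psi : {scalar R}) v r : (k * n <= N)%N ->
  (forall w a, log_ideal n N w a -> psi a = 0) -> psi (e_gen 1 ^+ (N * n)) != 0 ->
  whomog v r -> (forall w s, whomog w s -> psi (s * r) = 0) -> log_ideal n N v r.
Proof.
move=> kN psiJ psi1 hr psir.
have gJ := @log_ideal_gideal F n k n N : gideal whomog (log_ideal n N).
have [s hs P] := log_ideal_socle (leqnn n) kN.
(* e_1^(N n) is congruent to a multiple of the generator s of the socle. *)
have psis : psi s != 0.
  have h1 : whomog (N * n) (e_gen 1 ^+ (N * n)).
    by have := @graded_exp _ _ (@whomog1 F n) whomogM _ _ (N * n) (whomog_e F n 1); rewrite muln1.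
  case: (P _ _ h1) => [j /andP[j0 _]|/psiJ E|[_ [c /psiJ E]]].
  - apply: log_ideal_top => //; first by rewrite addnC; apply: whomogM => //; apply: whomog_e.
    by rewrite -addn1 leq_add2l.
  - by rewrite E eqxx in psi1.
  apply: contraNneq psi1 => s0; move/eqP: E.
  by rewrite linearB linearZ /= s0 mulr0 subr0.
have [m] := ubnP ((N * n).+1 - v)%N; elim: m v r hr psir => // m IHm v r hr psir lt.
have [lv|vl] := ltnP (N * n) v; first exact: log_ideal_top.
case: (P v r hr) => [j /andP[j0 jn]|//|[vN [c Jc]]].
  apply: IHm; [by rewrite addnC; apply: whomogM => //; apply: whomog_e | | lia].
  by move=> w t ht; rewrite mulrA; apply: psir (whomogM ht (whomog_e F n j)).
have c0 : c = 0.
  have := psiJ _ _ Jc; rewrite linearB linearZ /= -[r]mul1r (psir 0%N 1 (@whomog1 F n)).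
  by rewrite sub0r => /eqP; rewrite oppr_eq0 mulf_eq0 (negPf psis) orbF => /eqP.
by rewrite c0 scale0r subr0 in Jc.
Qed.

End Socle.

(** * The form on symmetric polynomials *)

Section Separation.
Variable (F : fieldType).

Lemma submx_orthogonal m n p (A : 'M[F]_(m, n)) (B : 'M_(p, n)) :
  (forall y : 'cV_n, A *m y = 0 -> B *m y = 0) -> (B <= A)%MS.
Proof.
move=> AB; rewrite submxE; apply/eqP/matrixP => i j.
have := AB (col j (cokermx A)); rewrite colE mulmxA mulmx_coker mul0mx => /(_ erefl).
by rewrite mulmxA -colE => /colP/(_ i); rewrite mxE => ->; rewrite !mxE.
Qed.

End Separation.

Section Functional.
Variables (F : numFieldType) (n k : nat).
Local Notation P := {mpoly F[n]}.
Local Notation S := [tuple mesym n F i.+1 | i < n].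
Local Notation T := (@dunkl F n k).
Local Notation act := (@act F n k).
Local Notation dform := (@dform F n k).
Local Notation mlog := (mlog F n k).
Implicit Types (p q h g : P).

Lemma dformDl q r p : dform (q + r) p = dform q p + dform r p.
Proof. by rewrite /dform actDl mcoeffD. Qed.

Lemma dformZl c q p : dform (c *: q) p = c * dform q p.
Proof. by rewrite /dform actZl mcoeffZ. Qed.

Lemma dform_suml I (s : seq I) (C : pred I) (E : I -> P) p :
  dform (\sum_(x <- s | C x) E x) p = \sum_(x <- s | C x) dform (E x) p.
Proof. by rewrite /dform act_suml raddf_sum. Qed.

Lemma dform_sumr I (s : seq I) (C : pred I) (E : I -> P) p :
  dform p (\sum_(x <- s | C x) E x) = \sum_(x <- s | C x) dform p (E x).
Proof. by rewrite dformC dform_suml; apply: eq_bigr => x _; rewrite dformC. Qed.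

Lemma dformZr c q p : dform q (c *: p) = c * dform q p.
Proof. by rewrite dformC dformZl dformC. Qed.

(** A monomial with exponents at most N either has degree less than m, or
    contains two distinct variables, and then T_j T_i M_m = 0 applies. *)
Lemma dform_mlog_box N m h : (k * n <= N < m)%N -> box N h -> dform (mlog m) h = 0.
Proof.
move=> /andP[kN Nm] bh; rewrite dformC [h]mpolyE big_seq dform_suml big1 // => a ah.
rewrite dformZl; apply/eqP; rewrite mulf_eq0; apply/orP; right; apply/eqP.
have [lt|ge] := ltnP (mdeg a) m.
  by apply: dform_homog_neq (mlog_homog F n k m) _; rewrite ?dhomogX // ltn_eqF.
have [i ai] : exists i, a i != 0%N.
  apply/existsP; apply: contraLR ge => /existsPn z; rewrite -ltnNge mdegE big1 => [|i _]; first by lia.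
  by apply/eqP/negPn/z.
have [j ji aj] : exists2 j, j != i & a j != 0%N.
  apply/exists_inP; apply: contraLR ge => /exists_inPn z; rewrite -ltnNge mdegE (bigD1 i) //= big1.
    by rewrite addn0; apply: leq_ltn_trans (box_msupp bh ah i) Nm.
  by move=> j /z; rewrite negbK => /eqP.
rewrite (mpolyX_U _ ai) (@mpolyX_U F n (a - U_(i)) j); last first.
  by rewrite mnmBE mnm1E ?(negPf ji) ?[_ == j]eq_sym ?(negPf ji) subn0.
rewrite mulrA mulrC /dform actM actXM.
by rewrite -['X_j]mulr1 actXM act1 dunkl_dunkl_mlog ?raddf0 ?mcoeff0 //; lia.
Qed.

(** The divided differences cancel in pairs. *)
Lemma act_psum1 p : act (\sum_i 'X_i) p = \sum_i p^`M(i).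
Proof.
rewrite act_suml; under eq_bigr => i _ do rewrite -['X_i]mulr1 actXM act1 dunklE.
rewrite sumrB -[RHS]subr0 sumrMnl; congr (_ - _).
set x := \sum_i _; suff /eqP : x *+ 2 = 0.
  rewrite -scaler_nat scaler_eq0 pnatr_eq0 /= => /eqP ->; exact: mul0rn.
rewrite mulr2n {2}/x (exchange_big_dep xpredT) //= /x -big_split /= big1 // => i _.
rewrite [X in _ + X](eq_bigl (fun j => j != i)); last by move=> j; rewrite eq_sym.
rewrite -big_split /= big1 // => j ji.
by rewrite divdiff_anti ?addNr // eq_sym.
Qed.

Lemma meval1_psum1 d p : p \is d.-homog ->
  (act (\sum_i 'X_i) p).@[fun=> 1] = d%:R * p.@[fun=> 1].
Proof.
move=> hp; rewrite act_psum1 raddf_sum /=.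
have E i : (p^`M(i)).@[fun=> 1] = \sum_(a <- msupp p) p@_a * (a i)%:R.
  rewrite [X in X^`M(i)]mpolyE mderiv_sum raddf_sum /=; apply: eq_bigr => a _.
  rewrite mderivZ mderivX !mevalZ mevalX big1 ?mulr1 // => j _.
  by rewrite expr1n.
under eq_bigr do rewrite E.
rewrite exchange_big /= [p in RHS]mpolyE raddf_sum mulr_sumr /= !big_seq.
apply: eq_bigr => a ap; rewrite -mulr_sumr mevalZ mevalX [X in _ * (_ * X)]big1 => [|j _]; last by rewrite expr1n.
by rewrite mulr1 mulrC -(dhomog_mf hp ap) /= mdegE natr_sum.
Qed.

Lemma dform_psum1 d p : p \is d.-homog -> dform ((\sum_i 'X_i) ^+ d) p = d`!%:R * p.@[fun=> 1].
Proof.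
elim: d p => [|d IHd] p hp.
  suff -> : p = (p@_0)%:MP by rewrite expr0 /dform act1 mul1r mevalC mcoeffC eqxx mulr1.
  apply/mpolyP => m; rewrite mcoeffC; case: (eqVneq 0%MM m) => [<-|m0]; first by rewrite mulr1.
  rewrite mulr0; apply/eqP/negPn/negP; rewrite -mcoeff_msupp => /(dhomog_mf hp)/eqP.
  by rewrite mdeg_eq0 eq_sym (negPf m0).
rewrite exprSr dformMl IHd; last first.
  rewrite -[X in X.-homog](subn1 d.+1); apply: act_homog => //; apply: rpred_sum => i _.
  by rewrite dhomogX /= mdeg1.
by rewrite (meval1_psum1 hp) mulrA -natrM mulnC -factS.
Qed.

(** The monomial Y^N, Y the product of all variables. *)
Definition topmon N : P := 'X_[[multinom N | _ < n]].

Lemma topmon_box N : box N (topmon N).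
Proof. by apply: boxX => l; rewrite mnmE. Qed.

Lemma topmon_homog N : topmon N \is (N * n).-homog.
Proof.
rewrite dhomogX /= mdegE; under eq_bigr do rewrite mnmE.
by rewrite sum_nat_const card_ord mulnC.
Qed.

Lemma topmon_sym N : topmon N \is symmetric.
Proof.
by apply/issymP => s; rewrite msymX; congr 'X_[_]; apply/mnmP => i; rewrite !mnmE.
Qed.

Definition psi h (q : P) : F := dform (q \mPo S) h.

Lemma psi_scalar h : scalar (psi h).
Proof. by move=> c p q; rewrite /psi raddfD /= linearZ /= dformDl dformZl. Qed.

HB.instance Definition _ h := GRing.isLinear.Build F P F *%R (psi h) (psi_scalar h).

Lemma ext_psi (f : {scalar P}) (I : nat -> P -> Prop) (s : seq (nat * P)) w a :
  (forall w a, I w a -> f a = 0) -> (forall z b, z \in s -> f (z.2 * b) = 0) ->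
  ext (@whomog F n) I s w a -> f a = 0.
Proof.
elim: s I => [|p s IHs] I fI fs /=; first exact: fI.
apply: IHs => [w' a' [c [b [Ic hb ->]]]|q b qs]; last by apply: fs; rewrite inE qs orbT.
by rewrite raddfD /= (fI _ _ Ic) fs ?mem_head // addr0.
Qed.

Lemma log_ideal_psi N h w a : (k * n <= N)%N -> box N h -> @log_ideal F n k n N w a -> psi h a = 0.
Proof.
move=> kN bh; apply: ext_psi => [{}w {}a [_ ra]|p b /mapP[m + ->]] /=.
  by rewrite -[a]rho_n ra raddf0.
rewrite mem_iota => /andP[Nm _].
rewrite /psi rmorphM /= log_genK dformMl (@dform_mlog_box N) ?kN //.
exact/box_act.
Qed.

Lemma log_ideal_low N w a : (w <= N)%N -> @log_ideal F n k n N w a -> a = 0.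
Proof.
move=> wN; suff K (s : seq (nat * P)) (I : nat -> P -> Prop) : (forall z, z \in s -> N < z.1)%N ->
    ext (@whomog F n) I s w a -> I w a.
  move/(K _ _ _) => [p /mapP[m + ->]|_]; first by rewrite mem_iota => /andP[].
  by rewrite rho_n.
elim: s I => //= p s IHs I ps E.
have [c [b [Ic + ->]]] := IHs _ (fun z zs => ps z ltac:(by rewrite inE zs orbT)) E.
rewrite /shifted leqNgt (leq_ltn_trans wN (ps p (mem_head _ _))) /= => ->.
by rewrite mulr0 addr0.
Qed.

Lemma act_sym q p : q \is symmetric -> p \is symmetric -> act q p \is symmetric.
Proof. by move=> /issymP sq /issymP sp; apply/issymP => s; rewrite msym_act sq sp. Qed.

Lemma comp_mesym_sym (q : P) : q \mPo S \is symmetric.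
Proof. by apply: mcomp_sym => i; rewrite -tnth_nth tnth_mktuple mesym_sym. Qed.

Lemma psi_topmon N : psi (topmon N) (e_gen F n 1 ^+ (N * n)) != 0.
Proof.
rewrite /psi rmorphXn /= e_genK mesym1E dform_psum1; last exact: topmon_homog.
rewrite mevalX big1 ?mulr1 => [|i _]; last by rewrite expr1n.
by rewrite pnatr_eq0 -lt0n fact_gt0.
Qed.

(** The functional of log_ideal_nondegenerate is q |-> [q, Y^N]; by adjointness
    it is enough to test r against the images of Y^N. *)
Lemma log_ideal_orthogonal N d (r : P) : (k * n <= N)%N -> whomog d r ->
  (forall w s, whomog w s -> act (s \mPo S) (topmon N) \is d.-homog ->
     dform (r \mPo S) (act (s \mPo S) (topmon N)) = 0) ->
  @log_ideal F n k n N d r.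
Proof.
move=> kN hr og; apply: (log_ideal_nondegenerate (psi := psi (topmon N))) => //.
- by move=> w a; apply: log_ideal_psi => //; exact: topmon_box.
- exact: psi_topmon.
move=> w s hs; rewrite /= /psi rmorphM /= mulrC dformMl.
have hs' : s \mPo S \is w.-homog by rewrite -mwmwgt_homogE.
have hr' : r \mPo S \is d.-homog by rewrite -mwmwgt_homogE.
have [lt|le] := ltnP (N * n) w.
  by rewrite (act_homog0 _ hs' (topmon_homog N) lt) /dform linear0 mcoeff0.
have ht : act (s \mPo S) (topmon N) \is (N * n - w).-homog.
  exact: act_homog (topmon_homog N) le.
have [E|ne] := eqVneq (N * n - w)%N d; last by rewrite dformC; exact: dform_homog_neq ht hr' ne.
by apply: (og w) => //; rewrite -E.
Qed.

(** With N at least the degree of g, the ideal of M_(N+1), ..., M_(N+n) is 0 in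
    this degree, so membership in it means g = 0. *)
Lemma dform_nondegenerate d g : g \is symmetric -> g \is d.-homog ->
  (forall q, q \is symmetric -> q \is d.-homog -> dform q g = 0) -> g = 0.
Proof.
move=> sg hg og; pose N := maxn d (k * n); have kN : (k * n <= N)%N by exact: leq_maxr.
have [r [Er hr]] := sym_fundamental_homog sg hg; rewrite -Er.
suff /(log_ideal_low (leq_maxl _ _)) -> : @log_ideal F n k n N d r by rewrite raddf0.
apply: log_ideal_orthogonal => // w s hs ht; rewrite Er dformC; apply: og => //.
by apply: act_sym (topmon_sym N); apply: comp_mesym_sym.
Qed.

End Functional.

(** * Functionals represented by the form *)

Section Representation.
Variables (F : numFieldType) (n k : nat).
Local Notation P := {mpoly F[n]}.
Local Notation dform := (@dform F n k).
Implicit Types (p q h g : P).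

Definition symz (m : 'X_{1..n}) : P := \sum_(s : 'S_n) msym s 'X_[m].

Lemma symz_sym m : symz m \is symmetric.
Proof.
apply/issymP => s; rewrite /symz raddf_sum /= [RHS](reindex_inj (mulIg s)) /=.
by apply: eq_bigr => t _; rewrite msymMm.
Qed.

Lemma msym_homog d s p : p \is d.-homog -> msym s p \is d.-homog.
Proof.
move=> hp; rewrite [p]mpolyE big_seq raddf_sum /=; apply: rpred_sum => m mp.
rewrite linearZ /= msymX rpredZ // dhomogX /= -(dhomog_mf hp mp) /= !mdegE.
by apply/eqP; rewrite [RHS](reindex_inj (@perm_inj _ s^-1)); apply: eq_bigr => i _; rewrite mnmE.
Qed.

Lemma symz_homog m : symz m \is (mdeg m).-homog.
Proof. by apply: rpred_sum => s _; apply: msym_homog; rewrite dhomogX. Qed.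

Lemma symmetrize p : p \is symmetric -> p = n`!%:R^-1 *: \sum_(m <- msupp p) p@_m *: symz m.
Proof.
move=> /issymP sp.
have -> : \sum_(m <- msupp p) p@_m *: symz m = \sum_(s : 'S_n) msym s p.
  under [RHS]eq_bigr => s _ do rewrite [p in msym s p]mpolyE raddf_sum /=.
  rewrite exchange_big /=; apply: eq_bigr => m _; rewrite scaler_sumr.
  by apply: eq_bigr => s _; rewrite linearZ.
under eq_bigr do rewrite sp.
rewrite sumr_const card_Sn -scaler_nat scalerA mulVf ?scale1r //.
by rewrite pnatr_eq0 -lt0n fact_gt0.
Qed.

Lemma sym_homog_ind d (C : P -> Prop) : C 0 -> (forall p q, C p -> C q -> C (p + q)) ->
  (forall c p, C p -> C (c *: p)) -> (forall m, mdeg m = d -> C (symz m)) ->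
  forall h, h \is symmetric -> h \is d.-homog -> C h.
Proof.
move=> C0 CD CZ Cs h sh hh; rewrite [h]symmetrize // big_seq; apply: (CZ).
by apply: big_ind => // m mh; apply/CZ/Cs/(dhomog_mf hh).
Qed.

(** The Gram matrix of the symmetrized monomials of degree d may be singular as
    these are repeated, but by nondegeneracy its kernel consists of relations
    between them. *)
Lemma dform_represent d (f : {scalar P}) :
  exists2 g, (g \is symmetric) && (g \is d.-homog) &
    forall h, h \is symmetric -> h \is d.-homog -> f h = dform g h.
Proof.
pose T := 'X_{1..n < d.+1}.
pose e (i : 'I_#|{: T}|) : P := if mdeg (enum_val i) == d then symz (enum_val i) else 0.
have es i : (e i \is symmetric) && (e i \is d.-homog).
  rewrite /e; case: eqP => [E|_]; first by rewrite symz_sym; move: (symz_homog (enum_val i)); rewrite E.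
  by rewrite rpred0 dhomog0.
have ee m : mdeg m = d -> exists i, symz m = e i.
  move=> md; have lt : (mdeg m < d.+1)%N by rewrite md.
  by exists (enum_rank (BMultinom lt)); rewrite /e enum_rankK /= md eqxx.
pose comb (y : 'I_#|{: T}| -> F) := \sum_i y i *: e i.
have comb_sym y : (comb y \is symmetric) && (comb y \is d.-homog).
  by apply/andP; split; apply: rpred_sum => i _; apply: rpredZ; case/andP: (es i).
pose A := \matrix_(i, j) dform (e i) (e j); pose B := \row_j f (e j).
have : (B <= A)%MS.
  apply: submx_orthogonal => y Ay.
  have g0 : comb (y^~ 0) = 0.
    have /andP[sg hg] := comb_sym (y^~ 0).
    apply: (@dform_nondegenerate F n k d) => // q sq hq.
    apply: (sym_homog_ind (C := fun q => dform q (comb (y^~ 0)) = 0)) sq hq => [|p p' Ep Eq|c p Ep|m /ee[i ->]].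
    - by rewrite /dform act0l mcoeff0.
    - by rewrite dformDl Ep Eq addr0.
    - by rewrite dformZl Ep mulr0.
    move/colP/(_ i): Ay; rewrite !mxE dform_sumr => E; rewrite -[RHS]E.
    by apply: eq_bigr => j _; rewrite dformZr mxE mulrC.
  apply/rowP => i; rewrite [in RHS]mxE mxE (ord1 i).
  transitivity (f (comb (y^~ 0))); last by rewrite g0 raddf0.
  rewrite /comb raddf_sum; apply: eq_bigr => j _. 
  by rewrite /= linearZ /= mxE mulrC.
move=> /submxP[D BD]; exists (comb (D 0)) => //.
apply: sym_homog_ind => [|p q Ep Eq|c p Ep|m /ee[j ->]].
- by rewrite raddf0 /dform linear0 mcoeff0.
- by rewrite raddfD /= Ep Eq dformC [dform _ (p + q)]dformC dformDl !(dformC _ (comb _)).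
- by rewrite linearZ /= Ep dformZr.
move/rowP/(_ j): BD; rewrite !mxE dform_suml => ->.
by apply: eq_bigr => i _; rewrite mxE dformZl.
Qed.

End Representation.

(** * The Cauchy kernel *)

Section CoefMap.
Variables (A B : idomainType) (r k : nat) (g : {additive A -> B}).
Implicit Types (p q : {mpoly A[r]}) (i j : 'I_r).
Local Notation G := (map_mpoly (n := r) g).

Lemma map_mpolyZX c m : G (c *: 'X_[m]) = g c *: 'X_[m].
Proof.
apply/mpolyP => a; rewrite mcoeff_map_mpoly !mcoeffZ !mcoeffX.
by case: eqP; rewrite ?mulr1 ?mulr0 ?raddf0.
Qed.

Lemma map_mpolyXM i p : G ('X_i * p) = 'X_i * G p.
Proof.
elim/mpolyind: p => [|c m p _ _ IH]; first by rewrite mulr0 raddf0 mulr0.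
by rewrite mulrDr raddfD /= IH raddfD /= mulrDr -scalerAr -mpolyXD !map_mpolyZX -scalerAr -mpolyXD.
Qed.

Lemma map_msym s p : G (msym s p) = msym s (G p).
Proof. by apply/mpolyP => m; rewrite mcoeff_map_mpoly !mcoeff_sym mcoeff_map_mpoly. Qed.

Lemma map_mderiv i p : G (p^`M(i)) = (G p)^`M(i).
Proof.
by apply/mpolyP => m; rewrite mcoeff_map_mpoly !mcoeff_deriv mcoeff_map_mpoly raddfMn.
Qed.

Lemma map_divdiff i j p : i != j -> G (divdiff i j p) = divdiff i j (G p).
Proof.
move=> ij; apply/esym/divdiff_uniq => //.
rewrite -map_msym -(raddfB G) /= divdiffE mulrBl raddfB /= !map_mpolyXM.
by rewrite mulrBl.
Qed.

(** So the operators in the variables z commute with those in y, which act on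
    coefficients, and with functionals of y. *)
Lemma map_dunkl i p : G (dunkl k i p) = dunkl k i (G p).
Proof.
rewrite !dunklE raddfB /= map_mderiv raddfMn /=; congr (_ - _ *+ _); rewrite (raddf_sum G) /=.
by apply: eq_bigr => j ji; rewrite map_divdiff // eq_sym.
Qed.

End CoefMap.

Section CoefDerivation.
Variables (A : idomainType) (r : nat) (g : {additive A -> A}).
Hypothesis gM : forall x y, g (x * y) = g x * y + x * g y.
Local Notation G := (map_mpoly (n := r) g).

Lemma map_derivation p q : G (p * q) = G p * q + p * G q.
Proof.
elim/mpoly_indX: p => [||p p' IH IH'|c p IH|i p IH].
- by rewrite mul0r raddf0 mul0r mul0r addr0.
- by rewrite mul1r -[1]mpolyC1 map_mpolyC (derivation1 gM) mpolyC0 mul0r add0r mul1r.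
- by rewrite mulrDl !(raddfD G) /= IH IH' !mulrDl; ring.
- have GZ (q' : {mpoly A[r]}) : G (c *: q') = g c *: q' + c *: G q'.
    by apply/mpolyP => m; rewrite mcoeffD !mcoeffZ !mcoeff_map_mpoly mcoeffZ gM.
  by rewrite -scalerAl !GZ IH mulrDl -!scalerAl scalerDr addrA.
by rewrite -mulrA !map_mpolyXM IH mulrDr !mulrA.
Qed.

End CoefDerivation.

(** The factors z_i + y_l of the kernel, the kernel, and the kernel with one
    factor less. The elements y_l belong to an abstract domain, which stands for
    the polynomials in y; of the Dunkl operators on these, only the commutation
    with y_l and the effect on symmetric elements matter. *)
HB.lock Definition cauchy_fac (A : idomainType) d r (y : 'I_d -> A) (x : 'I_r * 'I_d) : {mpoly A[r]} :=
  'X_x.1 + (y x.2)%:MP.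
HB.lock Definition cauchy (A : idomainType) d r k' (y : 'I_d -> A) : {mpoly A[r]} :=
  \prod_(x : 'I_r * 'I_d) cauchy_fac y x ^+ k'.+1.
HB.lock Definition cauchy_div (A : idomainType) d r k' (y : 'I_d -> A) (x : 'I_r * 'I_d) : {mpoly A[r]} :=
  cauchy_fac y x ^+ k' * \prod_(x' | x' != x) cauchy_fac y x' ^+ k'.+1.

Section Kernel.
Variables (A : idomainType) (d r k' : nat).
Local Notation k := k'.+1.
Variables (y : 'I_d -> A) (t dy : 'I_d -> {additive A -> A}) (sy : 'S_d -> {rmorphism A -> A}).
Hypothesis tX : forall l a, t l (y l * a) =
  y l * t l a + a - (\sum_(l' | l' != l) sy (tperm l l') a) *+ k.
Hypothesis t_sym : forall l a, (forall s, sy s a = a) -> t l a = dy l a.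
Hypothesis dyM : forall l a b, dy l (a * b) = dy l a * b + a * dy l b.
Hypothesis dyX : forall l l', dy l (y l') = (l' == l)%:R.
Hypothesis syX : forall s l, sy s (y l) = y (s l).
Local Notation Q := {mpoly A[r]}.
Implicit Types (i j : 'I_r) (l : 'I_d).
Local Notation T l := (map_mpoly (n := r) (t l)).
Local Notation D := (@dunkl A r k).
Local Notation cauchy_fac := (@cauchy_fac A d r y).
Local Notation cauchy := (cauchy r k' y).
Local Notation cauchy_div := (@cauchy_div A d r k' y).
Local Notation ymap s := (map_mpoly (n := r) (sy s)).

Lemma cauchy_fac_neq0 x : cauchy_fac x != 0.
Proof.
rewrite cauchy_fac.unlock; apply/eqP => /(congr1 (mcoeff U_(x.1))) /eqP.
rewrite mcoeffD mcoeffXU eqxx mcoeffC mcoeff0.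
by rewrite mnm1_eq0 mulr0 addr0 oner_eq0.
Qed.

Lemma cauchy_fac_mulI x : injective (fun p : Q => cauchy_fac x * p).
Proof. exact: (@mulfI _ _ (cauchy_fac_neq0 x)). Qed.

Lemma cauchyE x : cauchy = cauchy_fac x * cauchy_div x.
Proof. by rewrite cauchy.unlock cauchy_div.unlock (bigD1 x) //= mulrA -exprS. Qed.

Lemma msym_cauchy_fac s x : msym s (cauchy_fac x) = cauchy_fac (s x.1, x.2).
Proof.
by rewrite cauchy_fac.unlock raddfD /= msymXU; congr (_ + _); rewrite -alg_mpolyC linearZ /= rmorph1.
Qed.

Lemma msym_cauchy s : msym s cauchy = cauchy.
Proof.
rewrite cauchy.unlock rmorph_prod (reindex (fun x => (s^-1 x.1, x.2)%g)) /=; last first.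
  by exists (fun x => (s x.1, x.2)) => -[a b] _ /=; rewrite ?permK ?permKV.
by apply: eq_bigr => -[a b] _; rewrite rmorphXn /= msym_cauchy_fac /= permKV.
Qed.

Lemma ymap_cauchy_fac s x : ymap s (cauchy_fac x) = cauchy_fac (x.1, s x.2).
Proof.
by rewrite cauchy_fac.unlock raddfD /= map_mpolyC -['X_x.1]mulr1 map_mpolyXM rmorph1 !mulr1 /= syX.
Qed.

Lemma ymap_cauchy s : ymap s cauchy = cauchy.
Proof.
rewrite cauchy.unlock rmorph_prod (reindex (fun x => (x.1, s^-1 x.2)%g)) /=; last first.
  by exists (fun x => (x.1, s x.2)) => -[a b] _ /=; rewrite ?permK ?permKV.
by apply: eq_bigr => -[a b] _; rewrite rmorphXn /= ymap_cauchy_fac /= permKV.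
Qed.

Lemma msym_cauchy_div s x : msym s (cauchy_div x) = cauchy_div (s x.1, x.2).
Proof.
have E : cauchy_fac (s x.1, x.2) * msym s (cauchy_div x) = cauchy_fac (s x.1, x.2) * cauchy_div (s x.1, x.2).
  rewrite -(cauchyE (s x.1, x.2)) -(msym_cauchy_fac s x).
  rewrite -(rmorphM (msym s)).
  rewrite -(cauchyE x).
  exact: msym_cauchy.
exact: cauchy_fac_mulI E.
Qed.

Lemma ymap_cauchy_div s x : ymap s (cauchy_div x) = cauchy_div (x.1, s x.2).
Proof.
have E : cauchy_fac (x.1, s x.2) * ymap s (cauchy_div x) = cauchy_fac (x.1, s x.2) * cauchy_div (x.1, s x.2).
  rewrite -(cauchyE (x.1, s x.2)) -(ymap_cauchy_fac s x).
  rewrite -(rmorphM (map_mpoly (n := r) (sy s))).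
  rewrite -(cauchyE x).
  exact: ymap_cauchy.
exact: cauchy_fac_mulI E.
Qed.

Lemma derivation_cauchy (E : Q -> Q) : (forall p q, E (p * q) = E p * q + p * E q) ->
  E cauchy = (\sum_x E (cauchy_fac x) * cauchy_div x) *+ k.
Proof.
move=> EM; rewrite cauchy.unlock cauchy_div.unlock (derivation_prod EM) -sumrMnl; apply: eq_bigr => x _.
by rewrite (derivation_exp EM) /= mulrnAl mulrA.
Qed.

Lemma dunkl_cauchy i : D i cauchy = (\sum_l cauchy_div (i, l)) *+ k.
Proof.
rewrite dunklE big1 ?mul0rn ?subr0 => [|j ji]; last first.
  by rewrite divdiff_sym0 // ?msym_cauchy // eq_sym.
rewrite (derivation_cauchy (@mderivM _ _ i)); congr (_ *+ k).
have E x : (cauchy_fac x)^`M(i) = (x.1 == i)%:R by rewrite cauchy_fac.unlock mderivD mderivXU mderivC addr0 eq_sym.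
rewrite (eq_bigr (fun x => (x.1 == i)%:R * cauchy_div (x.1, x.2))) => [|[j l] _]; last by rewrite E.
rewrite -(pair_bigA _ (fun j l => (j == i)%:R * cauchy_div (j, l))) /= (bigD1 i) //= eqxx.
rewrite [X in _ + X]big1 ?addr0 => [|j /negPf ->]; last by rewrite big1 // => l _; rewrite mul0r.
by apply: eq_bigr => l _; rewrite mul1r.
Qed.

Lemma ydunkl_cauchy l : T l cauchy = (\sum_i cauchy_div (i, l)) *+ k.
Proof.
have -> : T l cauchy = map_mpoly (dy l) cauchy.
  apply/mpolyP => m; rewrite !mcoeff_map_mpoly; apply: t_sym => s.
  by rewrite -mcoeff_map_mpoly ymap_cauchy.
rewrite (derivation_cauchy (map_derivation (dyM l))); congr (_ *+ k).
have E x : map_mpoly (dy l) (cauchy_fac x) = (x.2 == l)%:R.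
  rewrite cauchy_fac.unlock raddfD /= map_mpolyC -['X_x.1]mulr1 map_mpolyXM -[1]mpolyC1 map_mpolyC /=.
  by rewrite (derivation1 (dyM l)) mpolyC0 mulr0 add0r dyX -mpolyC_nat.
rewrite (eq_bigr (fun x => (x.2 == l)%:R * cauchy_div (x.1, x.2))) => [|[i l'] _]; last by rewrite E.
rewrite -(pair_bigA _ (fun i l' => (l' == l)%:R * cauchy_div (i, l'))) /=; apply: eq_bigr => i _.
rewrite (bigD1 l) //= eqxx mul1r big1 ?addr0 // => l' /negPf ->.
by rewrite mul0r.
Qed.

(** The kernel is symmetric in z, so T_i is d_i on it; the right hand side is
    unchanged when the roles of y and z are exchanged. *)
Lemma dunkl_cauchy_div i l : cauchy_fac (i, l) * D i (cauchy_div (i, l)) =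
  (\sum_l' cauchy_div (i, l')) *+ k - cauchy_div (i, l) + (\sum_(j | j != i) cauchy_div (j, l)) *+ k.
Proof.
rewrite -dunkl_cauchy (cauchyE (i, l)) cauchy_fac.unlock !mulrDl dunklD dunklX !mul_mpolyC dunklZ.
rewrite (eq_bigr (fun j => cauchy_div (j, l))) => [|j ji]; last by rewrite msym_cauchy_div tpermL.
ring.
Qed.

Lemma ydunkl_cauchy_div i l : cauchy_fac (i, l) * T l (cauchy_div (i, l)) =
  (\sum_j cauchy_div (j, l)) *+ k - cauchy_div (i, l) + (\sum_(l' | l' != l) cauchy_div (i, l')) *+ k.
Proof.
rewrite -ydunkl_cauchy (cauchyE (i, l)) cauchy_fac.unlock !mulrDl raddfD /= map_mpolyXM.
have -> : T l ((y l)%:MP * cauchy_div (i, l)) = (y l)%:MP * T l (cauchy_div (i, l)) + cauchy_div (i, l)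
    - (\sum_(l' | l' != l) cauchy_div (i, l')) *+ k.
  rewrite [in RHS](eq_bigr (fun l' => ymap (tperm l l') (cauchy_div (i, l)))) => [|l' _]; last first.
    by rewrite ymap_cauchy_div tpermL.
  apply/mpolyP => m; rewrite mcoeffB mcoeffD mcoeffMn mcoeffCM !mcoeff_map_mpoly mcoeffCM tX.
  congr (_ - _ *+ _); rewrite (raddf_sum (mcoeff m)) /=; apply: eq_bigr => l' _.
  by rewrite mcoeff_map_mpoly.
ring.
Qed.

Lemma ydunkl_dunkl i l : T l (cauchy_div (i, l)) = D i (cauchy_div (i, l)).
Proof.
apply: (@cauchy_fac_mulI (i, l)); rewrite dunkl_cauchy_div ydunkl_cauchy_div.
rewrite [X in X *+ k - _ + _](bigD1 i) //= [X in _ = X *+ k - _ + _](bigD1 l) //=.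
ring.
Qed.

Lemma iter_ydunkl e i l : iter e (T l) (cauchy_div (i, l)) = iter e (D i) (cauchy_div (i, l)).
Proof.
have comm p : T l (D i p) = D i (T l p) := map_dunkl k (t l) i p.
elim: e => //= e IHe; rewrite IHe.
elim: e {IHe} => /= [|e IHe]; first exact: ydunkl_dunkl.
by rewrite comm IHe.
Qed.

(** T_l maps the kernel to k times the sum over i of the kernels without one
    factor z_i + y_l, on which T_l and T_i agree and commute. *)
Lemma power_sum_cauchy e : (0 < e)%N ->
  \sum_l iter e (T l) cauchy = \sum_i iter e (D i) cauchy.
Proof.
case: e => // e _.
have iterT l (c : nat) (E : 'I_r -> Q) : iter e (T l) ((\sum_i E i) *+ c) = (\sum_i iter e (T l) (E i)) *+ c.
  elim: e => //= e ->; rewrite raddfMn raddf_sum; by [].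
have iterD i (c : nat) (E : 'I_d -> Q) : iter e (D i) ((\sum_l E l) *+ c) = (\sum_l iter e (D i) (E l)) *+ c.
  elim: e {iterT} => //= e ->; rewrite dunklMn dunkl_sum; by [].
under eq_bigr do rewrite iterSr ydunkl_cauchy iterT.
under [RHS]eq_bigr do rewrite iterSr dunkl_cauchy iterD.
rewrite !sumrMnl exchange_big; congr (_ *+ _).
by apply: eq_bigr => i _; apply: eq_bigr => l _; rewrite iter_ydunkl.
Qed.

(** Apply phi to the coefficients of power_sum_cauchy: the operators in z
    commute with phi and phi kills the kernel. *)
Lemma vanish_power_sum (B : idomainType) (phi : {additive A -> B}) e : (0 < e)%N ->
  (forall m, phi cauchy@_m = 0) -> forall m, phi (\sum_l iter e (t l) cauchy@_m) = 0.
Proof.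
move=> e0 v m.
have K0 : map_mpoly (n := r) phi cauchy = 0.
  by apply/mpolyP => a; rewrite mcoeff_map_mpoly v mcoeff0.
have mi l : iter e (t l) cauchy@_m = (iter e (T l) cauchy)@_m.
  by elim: (e) => //= e' ->; rewrite mcoeff_map_mpoly.
under eq_bigr do rewrite mi.
rewrite -(raddf_sum (mcoeff m)) /= power_sum_cauchy // -mcoeff_map_mpoly.
rewrite (raddf_sum (map_mpoly (n := r) phi)) /= big1 ?mcoeff0 // => i _.
elim: (e) => //= e' IHe; rewrite map_dunkl IHe; exact: raddf0.
Qed.

End Kernel.

(** * Functionals that vanish on products of r coefficients *)

Section Reverse.
Variable A : comNzRingType.
Implicit Types (s : seq A).

(** The two products are reverse polynomials of each other. *)
Lemma coef_rev_prod s t :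
  (\prod_(c <- s) ('X + c%:P))`_t =
  if (t <= size s)%N then (\prod_(c <- s) (1 + c *: 'X))`_(size s - t) else 0.
Proof.
have big0 s' : forall u, (size s' < u)%N -> (\prod_(c <- s') (1 + c *: 'X))`_u = 0.
  elim: s' => [|c s' IH] [|u] //= lu; first by rewrite big_nil coef1.
  rewrite big_cons mulrDl mul1r coefD -scalerAl coefZ coefXM /= !IH ?mulr0 ?addr0 //.
  exact: ltnW.
elim: s t => [|c s IHs] t.
  by rewrite !big_nil !coef1; case: t.
rewrite !big_cons !mulrDl mul1r !coefD coefXM coefCM -scalerAl coefZ coefXM IHs /=.
case: t => [|t] /=.
  by rewrite add0r IHs !subn0 /= (big0 s (size s).+1) ?add0r.
rewrite ltnS IHs subSS; case: (ltngtP t (size s)) => [lt|gt|->].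
- by rewrite subn_eq0 leqNgt lt /= subnS.
- by rewrite mulr0 addr0.
by rewrite subnn /= !mulr0.
Qed.

Lemma coef_rev_pow d k (y : 'I_d -> A) t :
  (\prod_l ('X + (y l)%:P) ^+ k)`_t =
  if (t <= k * d)%N then (\prod_l (1 + y l *: 'X) ^+ k)`_(k * d - t) else 0.
Proof.
pose s := flatten [seq nseq k (y l) | l <- enum 'I_d].
have sz : size s = (k * d)%N.
  rewrite /s size_flatten /shape -map_comp (eq_map (g := fun=> k)) => [|l]; last exact: size_nseq.
  by rewrite sumnE big_map big_enum sum_nat_const card_ord mulnC.
have E (f : A -> {poly A}) : \prod_l f (y l) ^+ k = \prod_(c <- s) f c.
  rewrite /s big_flatten big_map big_enum; apply: eq_bigr => l _.
  by rewrite big_nseq iter_mulr_1.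
by rewrite (E (fun c => 'X + c%:P)) (E (fun c => 1 + c *: 'X)) coef_rev_prod sz.
Qed.

End Reverse.

Section Separated.
Variables (A : comNzRingType) (r : nat).

Lemma mcoeff_prod_univariate (p : 'I_r -> {poly A}) m :
  (\prod_i (map_poly (@mpolyC r A) (p i)).['X_i])@_m = \prod_i (p i)`_(m i).
Proof.
(* a bound for all exponents that occur *)
pose b := (\sum_i size (p i) + mdeg m).+1.
have E i : (map_poly (@mpolyC r A) (p i)).['X_i] = \sum_(t < b) (p i)`_t *: 'X_i ^+ t.
  rewrite (@horner_coef_wide _ b) => [|].
    by apply: eq_bigr => t _; rewrite coef_map mul_mpolyC.
  apply: leq_trans (size_poly _ _) _; by rewrite /b ltnW // ltnS (bigD1 i) //= -addnA leq_addr.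
under eq_bigr do rewrite E.
rewrite bigA_distr_bigA raddf_sum /=.
have mb i : (m i < b)%N by rewrite /b ltnS mdegE (bigD1 i) //= [X in (_ <= _ + X)%N](bigD1 i) //=; lia.
rewrite (bigD1 [ffun i => Ordinal (mb i)]) //= [X in _ + X]big1 => [|f fm].
  rewrite addr0 scaler_prod mcoeffZ.
  under [X in _ * X@_m]eq_bigr do rewrite ffunE /=.
  rewrite -mpolyXE_id mcoeffX eqxx mulr1; apply: eq_bigr => i _.
  by rewrite ffunE.
rewrite scaler_prod mcoeffZ (_ : \prod_i _ = 'X_[[multinom (f i : nat) | i < r]]).
  rewrite mcoeffX; case: eqP => [E'|]; last by rewrite mulr0.
  case/eqP: fm; apply/ffunP => i; apply/val_inj; rewrite ffunE /=.
  by move/mnmP/(_ i): E'; rewrite mnmE.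
by rewrite mpolyXE_id; apply: eq_bigr => i _; rewrite mnmE.
Qed.

End Separated.

Section KernelCoef.
Variables (A : idomainType) (d r k' : nat) (y : 'I_d -> A).
Local Notation k := k'.+1.
Local Notation P t := ((\prod_l (1 + y l *: 'X) ^+ k)`_t).

Lemma mcoeff_cauchy m : (cauchy r k' y)@_m =
  \prod_(i < r) (if (m i <= k * d)%N then P (k * d - m i) else 0).
Proof.
rewrite (eq_bigr (fun i => (\prod_l ('X + (y l)%:P) ^+ k)`_(m i))) => [|i _]; last first.
  by rewrite coef_rev_pow.
rewrite -mcoeff_prod_univariate; congr (_@_m).
rewrite cauchy.unlock (eq_bigr (fun x => cauchy_fac y (x.1, x.2) ^+ k)) => [|[] //].
rewrite -(pair_bigA _ (fun i l => cauchy_fac y (i, l) ^+ k)) /=; apply: eq_bigr => i _.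
rewrite rmorph_prod horner_prod; apply: eq_bigr => l _.
by rewrite rmorphXn horner_exp rmorphD /= map_polyX map_polyC hornerD hornerX hornerC cauchy_fac.unlock.
Qed.

End KernelCoef.

Section Stability.
Variables (F : numFieldType) (d r k' : nat).
Local Notation k := k'.+1.
Local Notation P := {mpoly F[d]}.
Local Notation act := (@act F d k).
Local Notation S := [tuple mesym d F i.+1 | i < d].
Local Notation y := (fun l : 'I_d => 'X_l : P).
Local Notation cauchy := (cauchy r k' y).

Definition vanish (phi : P -> F) := forall m, phi cauchy@_m = 0.

Definition comp_act (phi : {scalar P}) (q p : P) : F := phi (act q p).

Lemma comp_act_scalar phi q : scalar (comp_act phi q).
Proof. by move=> c p p'; rewrite /comp_act !linearP. Qed.

HB.instance Definition _ phi q := GRing.isLinear.Build F P F *%R _ (comp_act_scalar phi q).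

Definition stable q := forall phi : {scalar P}, vanish phi -> vanish (comp_act phi q).

Lemma stable1 : stable 1. Proof. by move=> phi v m; rewrite /comp_act act1. Qed.

Lemma stable0 : stable 0. Proof. by move=> phi v m; rewrite /comp_act act0l raddf0. Qed.

Lemma stableD p q : stable p -> stable q -> stable (p + q).
Proof.
move=> sp sq phi v m; rewrite /comp_act actDl raddfD /=.
by have := sp phi v m; have := sq phi v m; rewrite /comp_act => -> ->; rewrite addr0.
Qed.

Lemma stableZ c p : stable p -> stable (c *: p).
Proof.
move=> sp phi v m; rewrite /comp_act actZl linearZ /=.
by have := sp phi v m; rewrite /comp_act => ->; rewrite mulr0.
Qed.

Lemma stableM p q : stable p -> stable q -> stable (p * q).
Proof.
move=> sp sq phi v m; rewrite /comp_act actM.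
exact: (sq (comp_act phi p : {scalar P}) (sp phi v)).
Qed.

Lemma stable_sum I (s : seq I) (C : pred I) (E : I -> P) :
  (forall i, C i -> stable (E i)) -> stable (\sum_(i <- s | C i) E i).
Proof. by move=> h; apply: big_ind => //; [exact: stable0 | exact: stableD]. Qed.

Lemma act_psum e p : act (psum F d e) p = \sum_l iter e (dunkl k l) p.
Proof.
rewrite act_suml; apply: eq_bigr => l _.
by elim: e => [|e IHe]; rewrite ?expr0 ?act1 // exprS actXM IHe.
Qed.

Lemma vanish_dunkl_power_sum (phi : {scalar P}) (e : nat) : (0 < e)%N -> vanish phi ->
  forall m, phi (\sum_l iter e (dunkl k l) cauchy@_m) = 0.
Proof.
apply: (@vanish_power_sum _ d r k' y (fun l => dunkl k l) (fun l => mderiv l) (fun s => msym s)).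
- by move=> l a; exact: dunklX.
- move=> l a sa; rewrite /= dunklE big1 ?mul0rn ?subr0 // => l' l'l.
  by rewrite divdiff_sym0 // 1?eq_sym // sa.
- by move=> l a b; exact: mderivM.
- by move=> l l'; rewrite /= mderivXU eq_sym.
by move=> s l; exact: msymXU.
Qed.

Lemma stable_psum e : (0 < e)%N -> stable (psum F d e).
Proof. by move=> e0 phi v m; rewrite /comp_act act_psum vanish_dunkl_power_sum. Qed.

(** Newton's identities, read off from e (log e)' = e'. *)
Lemma newton m : mesym d F m.+1 *+ m.+1 =
  \sum_(j < m.+1) mesym d F j * (logc F d (m - j).+1 *+ (m - j).+1).
Proof.
have := congr1 (fun p : {poly P} => p`_m) (logc_deriv F d m.+1).
rewrite /= coefD coef_deriv coef_gen_elem coefXnM ltnSn addr0 => <-.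
rewrite coefM; apply: eq_bigr => j _.
by rewrite coef_gen_elem coef_deriv coef_poly !ltnS leq_subr.
Qed.

Lemma stable_mesym m : stable (mesym d F m).
Proof.
elim/ltn_ind: m => -[|m] IH; first by rewrite mesym0E; exact: stable1.
rewrite -[mesym _ _ _]scale1r -(mulVf (_ : m.+1%:R != 0 :> F)) ?pnatr_eq0 // -scalerA scaler_nat newton.
apply/stableZ/stable_sum => j _; apply: stableM; first by apply: IH.
by rewrite -scaler_nat; apply/stableZ/stableZ/stable_psum.
Qed.

Lemma stable_sym q : stable (q \mPo S).
Proof.
elim/mpoly_indX: q => [||p q IH IH'|c p IH|i p IH].
- by rewrite comp_mpoly0; exact: stable0.
- by rewrite comp_mpoly1; exact: stable1.
- by rewrite comp_mpolyD; exact: stableD.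
- by rewrite comp_mpolyZ; exact: stableZ.
rewrite rmorphM /=; apply: stableM => //.
by rewrite comp_mpolyXU -tnth_nth tnth_mktuple; exact: stable_mesym.
Qed.

End Stability.

Section Vanishing.
Variables (F : numFieldType) (d r k : nat).
Local Notation P := {mpoly F[d]}.
Local Notation pw := (pw F d k).
Local Notation S := [tuple mesym d F i.+1 | i < d].

Lemma pwE : pw = \prod_l (1 + 'X_l *: 'X) ^+ k.
Proof. by rewrite /pw /gen_elem prodrXl. Qed.

Lemma pw_cauchy k' m : k = k'.+1 ->
  (cauchy r k' (fun l : 'I_d => 'X_l : P))@_m =
  \prod_(i < r) (if (m i <= k * d)%N then pw`_(k * d - m i) else 0).
Proof. by move=> E; rewrite mcoeff_cauchy pwE E. Qed.

Lemma pw_top : pw`_(k * d) = topmon F d k.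
Proof.
rewrite /pw coef_exp_top; last exact: size_gen_elem.
rewrite coef_gen_elem mesymnnE /topmon mpolyXE_id -prodrXl.
by apply: eq_bigr => i _; rewrite mnmE.
Qed.

Lemma box_pihomog N v (g : P) : box N g -> box N (pihomog mdeg v g).
Proof.
move=> bg; rewrite pihomogE big_seq_cond; apply: big_ind => [||m /andP[mg _]].
- exact: box0.
- exact: boxD.
by apply/boxZ/boxX/(box_msupp bg).
Qed.

(** By homogeneity phi may be replaced on each degree by [p, .] with p
    symmetric. Stability at the coefficient Y^(k r) of the kernel puts p into the
    ideal of M_m, N < m <= N + d, N = k r, which is orthogonal to g. The case
    k = 0, with only constants, is apart because the kernel is then 1 and has no
    factor to remove. *)
Lemma vanish_box (phi : {scalar P}) (g : P) : (d <= r)%N ->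
  (forall J : 'I_r -> nat, phi (\prod_i pw`_(J i)) = 0) ->
  g \is symmetric -> box (k * r) g -> phi g = 0.
Proof.
move=> dr v sg bg.
have [k0|kp] := posnP k.
  have : phi 1 = 0.
    have := v (fun=> 0%N); rewrite big1 // => i _.
    by rewrite /pw k0 expr0 coef1.
  move=> v1; suff -> : g = g@_0 *: 1 by rewrite linearZ /= v1 mulr0.
  apply/mpolyP => m; rewrite mcoeffZ mcoeff1; case: eqP => [->|m0]; first by rewrite mulr1.
  have [i mi] : exists i, (0 < m i)%N.
    apply/existsP; apply: contra_notT m0 => /existsPn z; apply/mnmP => i.
    by rewrite mnm0E; apply/eqP; rewrite -leqn0 leqNgt.
  by rewrite mulr0 (bg m i) // k0.
have [k' kE] : exists k', k = k'.+1 by exists k.-1; rewrite prednK.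
have vk : vanish r k' phi.
  move=> m; rewrite (pw_cauchy _ kE).
  have [/forallP all_le|/forallPn[i ni]] := boolP [forall i : 'I_r, (m i <= k * d)%N].
    under eq_bigr do rewrite all_le.
    exact: v (fun i => (k * d - m i)%N).
  by rewrite (bigD1 i) //= (negPf ni) mul0r raddf0.
rewrite (pihomog_partitionE (leqnn (msize g))) raddf_sum big1 //= => w _.
set h := pihomog _ _ _.
have sh : h \is symmetric by apply: pihomog_sym.
have hh : h \is w.-homog by apply: pihomogP.
have bh : box (k * r) h by apply: box_pihomog.
have [p /andP[sp hp] phiE] := dform_represent k (val w) phi.
have [q [qE hq]] := sym_fundamental_homog sp hp.
have kN : (k * d <= k * r)%N by rewrite leq_mul2l dr orbT.
rewrite phiE // -qE; apply: (@log_ideal_psi F d k (k * r) h w q) => //.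
apply: (@log_ideal_orthogonal F d k (k * r) w q) => // u s hs ht; rewrite qE -phiE //; last first.
  by apply: act_sym (topmon_sym _ _ _); apply: comp_mesym_sym.
(* The coefficient of the kernel at the exponent 0 is Y^(k r). *)
have := @stable_sym F d r k' s phi vk 0%MM; rewrite /comp_act (pw_cauchy _ kE).
rewrite -kE; under eq_bigr do rewrite mnm0E leq0n subn0 pw_top.
rewrite prodr_const card_ord (_ : topmon F d k ^+ r = topmon F d (k * r)) //.
rewrite /topmon mpolyXn; congr 'X_[_]; apply/mnmP => i.
by rewrite mulmnE !mnmE.
Qed.

End Vanishing.

(** * Products of elementary symmetric polynomials *)

Section Span.
Variables (F : numFieldType) (n a : nat).
Local Notation P := {mpoly F[n]}.
Local Notation index := {ffun 'I_a -> 'I_n.+1}.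
Implicit Types (f g : P).

Definition mesyms (J : index) : P := \prod_i mesym n F (J i).

Lemma symle_box (g : P) : g \is symle a <-> g \is symmetric /\ box a g.
Proof.
split=> [/symleP[sg bg]|[sg bg]]; first split=> // m l lt.
  by apply/eqP; apply: contraTT lt => nz; rewrite -leqNgt bg // mcoeff_msupp.
by apply/symleP; split=> // m mg i; apply: box_msupp bg mg i.
Qed.

Lemma box_mul N M f g : box N f -> box M g -> box (N + M) (f * g).
Proof.
move=> bf bg; rewrite [f]mpolyE [g]mpolyE mulr_suml.
rewrite big_seq; apply: big_ind => [||m mf]; [exact: box0 | exact: boxD |].
rewrite mulr_sumr big_seq; apply: big_ind => [||m' mg]; [exact: box0 | exact: boxD |].
rewrite -scalerAl -scalerAr; do 2!apply: boxZ; rewrite -mpolyXD; apply: boxX => l.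
by rewrite mnmDE leq_add // (box_msupp bf mf, box_msupp bg mg).
Qed.

Lemma box_mesym j : box 1 (mesym n F j).
Proof.
move=> m l lt; rewrite mcoeff_mesym; case: (boolP (mechar j m)) => // /andP[_ /forallP/(_ l)].
by rewrite leqNgt lt.
Qed.

Lemma mesyms_symle J : mesyms J \is symle a.
Proof.
apply/symle_box; split; first by apply: rpred_prod => i _; exact: mesym_sym.
rewrite /mesyms -[a in box a]card_ord -sum1_card.
elim: (index_enum _) => [|i s IHs]; first by rewrite !big_nil -mpolyX0; apply: boxX => l; rewrite mnm0E.
by rewrite !big_cons; apply: box_mul; [exact: box_mesym | exact: IHs].
Qed.

Definition spanned f := exists t : index -> F, f = \sum_J t J *: mesyms J.

Lemma spannedD f g : spanned f -> spanned g -> spanned (f + g).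
Proof.
move=> [t ->] [u ->]; exists (fun J => t J + u J).
by rewrite -big_split; apply: eq_bigr => J _; rewrite scalerDl.
Qed.

Lemma spannedZ c f : spanned f -> spanned (c *: f).
Proof.
move=> [t ->]; exists (fun J => c * t J).
by rewrite scaler_sumr; apply: eq_bigr => J _; rewrite scalerA.
Qed.

Lemma spanned0 : spanned 0.
Proof. by exists (fun=> 0); rewrite big1 // => J _; rewrite scale0r. Qed.

Lemma spanned_seq (s : seq nat) : (size s <= a)%N -> all (fun j => j <= n)%N s ->
  spanned (\prod_(j <- s) mesym n F j).
Proof.
move=> sa sn; pose J : index := [ffun i : 'I_a => inord (nth 0%N s i)].
exists (fun J' => (J' == J)%:R); rewrite (bigD1 J) //= eqxx scale1r.
rewrite [X in _ + X]big1 ?addr0 => [|J' /negPf ->]; last by rewrite scale0r.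
rewrite /mesyms (eq_bigr (fun i : 'I_a => mesym n F (nth 0%N s i))) => [|i _]; last first.
  rewrite ffunE inordK // ltnS; case: (ltnP i (size s)) => [lt|ge].
    by move/allP: sn; apply; rewrite mem_nth.
  by rewrite nth_default.
rewrite (big_nth 0%N) -(big_mkord xpredT (fun i => mesym n F (nth 0%N s i))).
rewrite [RHS](big_cat_nat _ (n := size s)) //= [X in _ * X]big_nat_cond [X in _ * X]big1 ?mulr1 // => i.
by rewrite andbT => /andP[ge _]; rewrite nth_default // mesym0E.
Qed.

(** Induction on the leading monomial m. The product of elementary symmetric
    polynomials with leading monomial m has as many factors as the first exponent
    of m, so at most a of them; the index 0 fills up their number to a. *)
Lemma symle_spanned f : f \is symle a -> spanned f.
Proof.
move: {2}(mlead f) (erefl (mlead f)) => m; elim/(ltmwf (n := n)): m f => m IH f mE.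
have [->|nz] := eqVneq f 0; first by move=> _; exact: spanned0.
move=> bf; have /symle_box[sf bxf] := bf.
have := symf1P sf; move=> /and3P[lt sym2 /eqP fE].
pose c := nth 0%N (mlead f); pose E i := (c i - c i.+1)%N.
(* The sizes of the factors: the partition conjugate to the exponent m. *)
pose s := flatten [seq nseq (E i) i.+1 | i <- index_iota 0 n].
have sE : ('X_[[multinom E (val i) | i < n]] : P) \mPo [tuple mesym n F i.+1 | i < n] = \prod_(j <- s) mesym n F j.
  rewrite comp_mpolyX /s big_flatten big_map big_mkord.
  apply: eq_bigr => i _; rewrite tnth_mktuple mnmE big_nseq iter_mulr_1; by [].
have m_sorted := mlead_msym_sorted sf.
have mf : mlead f \in msupp f by rewrite mlead_supp.
have ss : (size s <= a)%N.
  have -> : size s = c 0%N.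
    rewrite /s size_flatten /shape -map_comp (eq_map (g := E)) => [|i]; last exact: size_nseq.
    rewrite sumnE big_map /E sumn_range //.
      by rewrite /c [X in (_ - X)%N]nth_default ?subn0 // size_tuple.
    move=> i j; rewrite subn0 !addn0 => /andP[ij]; rewrite ltnS leq_eqVlt => /orP[/eqP ->|jn].
      by rewrite /c nth_default // size_tuple.
    have := m_sorted (Ordinal (leq_ltn_trans ij jn)) (Ordinal jn) ij.
    by rewrite !(mnm_nth 0%N).
  rewrite /c; case: (posnP n) => [n0|np].
    by rewrite nth_default // size_tuple n0.
  by rewrite -[0%N]/(val (Ordinal np)) -(mnm_nth 0%N); apply: box_msupp bxf mf _.
have sn : all (fun j => j <= n)%N s.
  apply/allP => j /flatten_mapP[u]; rewrite mem_index_iota /= => lt_in.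
  by move=> /nseqP[-> _].
have [t tE] := spanned_seq ss sn.
have b1 : (symf1 f).1 \mPo [tuple mesym n F i.+1 | i < n] \is symle a.
  rewrite /symf1 (negPf nz) /= comp_mpolyZ sE tE; apply: rpredZ; apply: rpred_sum => J _.
  by apply/rpredZ/mesyms_symle.
have f2E : (symf1 f).2 = f - ((symf1 f).1 \mPo [tuple mesym n F i.+1 | i < n]).
  by apply/esym/eqP; rewrite subr_eq addrC {1}fE.
rewrite fE; apply: spannedD.
  rewrite /symf1 (negPf nz) /= comp_mpolyZ sE; apply: spannedZ; exact: spanned_seq.
case/orP: lt => [/eqP ->|lt]; first exact: spanned0.
by apply: (IH _ _ _ erefl); [rewrite -mE | rewrite f2E; apply: rpredB].
Qed.

End Span.

(** * The k-fold map *)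

Section Duality.
Variables (K A B : comNzRingType) (a d k : nat) (y : 'I_d -> A) (x : 'I_a -> B).
Variable f : {rmorphism A -> {mpoly B[d]}}.
Variables (evA : 'X_{1..d} -> {additive A -> K}) (evB : 'X_{1..a} -> {additive B -> K}).
Hypothesis fy : forall l, f (y l) = 'X_l.
Hypothesis evE : forall c m (e : 'X_{1..a}) m',
  evB m' ((f c)@_m * \prod_i x i ^+ e i) = evA m c * (e == m')%:R.

Definition swap : {mpoly A[a]} -> {mpoly B[d]} := mmap f (fun i => (x i)%:MP).
HB.instance Definition _ := GRing.RMorphism.on swap.

Lemma mcoeff_swap p m m' : evB m' (swap p)@_m = evA m p@_m'.
Proof.
elim/mpolyind: p => [|c e p _ _ IH]; first by rewrite raddf0 !mcoeff0 !raddf0.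
rewrite raddfD /= !mcoeffD !raddfD /= IH; congr (_ + _).
have -> : swap (c *: 'X_[e]) = f c * (\prod_i x i ^+ e i)%:MP.
  rewrite -mul_mpolyC rmorphM /= /swap mmapC mmapX /mmap1 rmorph_prod /=.
  by under [in RHS]eq_bigr do rewrite rmorphXn.
rewrite mulrC mcoeffCM mulrC evE mcoeffZ mcoeffX.
by case: eqP => _; rewrite ?mulr1 ?mulr0 ?raddf0.
Qed.

(** The coefficients of prod_(i,l) (1 + x_i y_l)^k, computed in two ways. The
    rings A and B stand for polynomials in y and in x; swap exchanges the two
    sets of variables, and evA m and evB J are the coefficients at m and at J. *)
Lemma prod_coef_duality (J : 'X_{1..a}) (m : 'X_{1..d}) :
  evA m (\prod_i (\prod_l (1 + y l *: 'X) ^+ k)`_(J i)) =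
  evB J (\prod_l (\prod_i (1 + x i *: 'X) ^+ k)`_(m l)).
Proof.
pose w1 (i : 'I_a) (l : 'I_d) : {mpoly A[a]} := 1 + (y l)%:MP * 'X_i.
pose w2 (i : 'I_a) (l : 'I_d) : {mpoly B[d]} := 1 + (x i)%:MP * 'X_l.
have E1 : \prod_i (\prod_l (1 + y l *: 'X) ^+ k)`_(J i) = (\prod_i \prod_l w1 i l ^+ k)@_J.
  rewrite -mcoeff_prod_univariate; congr (_@_ _); apply: eq_bigr => i _.
  rewrite rmorph_prod horner_prod; apply: eq_bigr => l _.
  by rewrite rmorphXn horner_exp rmorphD rmorph1 /= map_polyZ map_polyX hornerD hornerZ hornerX hornerC.
have E2 : \prod_l (\prod_i (1 + x i *: 'X) ^+ k)`_(m l) = (\prod_l \prod_i w2 i l ^+ k)@_m.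
  rewrite -mcoeff_prod_univariate; congr (_@_ _); apply: eq_bigr => l _.
  rewrite rmorph_prod horner_prod; apply: eq_bigr => i _.
  by rewrite rmorphXn horner_exp rmorphD rmorph1 /= map_polyZ map_polyX hornerD hornerZ hornerX hornerC.
rewrite E1 E2 -mcoeff_swap exchange_big /=; congr (evB _ _@_ _).
rewrite rmorph_prod; apply: eq_bigr => l _; rewrite rmorph_prod; apply: eq_bigr => i _.
rewrite rmorphXn rmorphD rmorph1 rmorphM /=; congr ((1 + _) ^+ k).
rewrite mulrC; congr (_ * _); last by rewrite /swap mmapC /= fy.
rewrite /swap mmapX /mmap1 (bigD1 i) //= mnm1E eqxx big1 ?mulr1 // => j ji.
by rewrite mnm1E eq_sym (negPf ji).
Qed.

End Duality.

Lemma prod_pw_duality (F : numFieldType) (a d k : nat) (J : 'X_{1..a}) (m : 'X_{1..d}) :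
  (\prod_i (pw F d k)`_(J i))@_m = (\prod_l (pw F a k)`_(m l))@_J.
Proof.
rewrite !pwE.
apply: (@prod_coef_duality F {mpoly F[d]} {mpoly F[a]} a d k (fun l => 'X_l) (fun i => 'X_i)
  (map_mpoly (@mpolyC a F)) (fun m => mcoeff m) (fun m => mcoeff m)).
- by move=> l; exact: map_mpolyX.
move=> c {}m e m'; rewrite /= mcoeff_map_mpoly /= -mpolyXE_id mcoeffCM mcoeffX.
by [].
Qed.

Section Kfold.
Variables (F : numFieldType) (a d k : nat).
Local Notation kf := (@kfold_subst F d k).

Lemma kfold_mesym j : kf (mesym (k * d) F j) = (pw F d k)`_j.
Proof.
rewrite -coef_gen_elem pwE -[LHS](coef_map (comp_mpoly _)) /=; congr (_`_j).
rewrite /gen_elem rmorph_prod (partition_big (@kfold_idx d k) xpredT) //=.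
under eq_bigr => l _.
  rewrite (eq_bigr (fun=> 1 + 'X_l *: 'X)) => [|i /eqP il]; last first.
    by rewrite rmorphD rmorph1 /= map_polyZ map_polyX /= comp_mpolyXU -tnth_nth tnth_mktuple il.
  rewrite prodr_const kfold_idx_card.
  over.
by [].
Qed.

Lemma kfold_comb (I : finType) (c : I -> F) (p : I -> {mpoly F[k * d]}) :
  kf (\sum_i c i *: p i) = \sum_i c i *: kf (p i).
Proof.
rewrite /kfold_subst (raddf_sum (comp_mpoly _)) /=; apply: eq_bigr => i _.
exact: comp_mpolyZ.
Qed.

Lemma kfold_mesyms J : kf (mesyms F J) = \prod_(i < a) (pw F d k)`_(J i).
Proof. by rewrite /kfold_subst /mesyms rmorph_prod; apply: eq_bigr => i _; exact: kfold_mesym. Qed.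

End Kfold.

Section Main.
Variables (F : numFieldType) (a d k : nat).

Lemma pw_gt j : (k * d < j)%N -> (pw F d k)`_j = 0.
Proof. by move=> lt; have /leq_sizeP := size_pw F d k; apply. Qed.

Definition mon r b (m : {ffun 'I_r -> 'I_b}) : 'X_{1..r} := [multinom (m i : nat) | i < r].

Lemma mon_inj r b : injective (@mon r b).
Proof.
move=> m m' E; apply/ffunP => i; apply/val_inj.
by move/mnmP/(_ i): E; rewrite !mnmE.
Qed.

Definition mcomb r b (t : {ffun 'I_r -> 'I_b} -> F) (p : {mpoly F[r]}) : F :=
  \sum_m t m * p@_(mon m).

Lemma mcomb_scalar r b t : scalar (@mcomb r b t).
Proof.
move=> c p q; rewrite /mcomb mulr_sumr -big_split; apply: eq_bigr => m _.
by rewrite mcoeffD mcoeffZ mulrDr mulrCA.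
Qed.

HB.instance Definition _ r b t :=
  GRing.isLinear.Build F {mpoly F[r]} F *%R (@mcomb r b t) (mcomb_scalar t).

(** A linear functional that vanishes on the images of all products of
    elementary symmetric polynomials vanishes on g, so g is a combination of these
    images. *)
Lemma kfold_surjective : (d <= a)%N ->
  forall g : Lambda F (k * a) d, exists f : Lambda F a (k * d), kfold_map F a d k f = g.
Proof.
move=> da [g gbox]; have /symle_box[sg bg] := gbox.
pose T := {ffun 'I_d -> 'I_(k * a).+1}; pose U := {ffun 'I_a -> 'I_(k * d).+1}.
pose e (J : U) : {mpoly F[d]} := \prod_i (pw F d k)`_(J i).
pose A := \matrix_(i < #|{: U}|, j < #|{: T}|) (e (enum_val i))@_(mon (enum_val j)).
pose B := \row_(j < #|{: T}|) g@_(mon (enum_val j)).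
have : (B <= A)%MS.
  apply: submx_orthogonal => y Ay.
  pose t (m : T) := y (enum_rank m) 0.
  have tE p : mcomb t p = \sum_(j < #|{: T}|) p@_(mon (enum_val j)) * y j 0.
    rewrite /mcomb [LHS](reindex (fun j : 'I_#|{: T}| => enum_val j)) /=; last first.
      by apply: onW_bij; exact: enum_val_bij.
    by apply: eq_bigr => j _; rewrite /t enum_valK mulrC.
  have van : mcomb t g = 0.
    apply: (@vanish_box F d a k (mcomb t : {scalar _})) => // J /=.
    have [/forallP leJ|/forallPn[i ni]] := boolP [forall i : 'I_a, (J i <= k * d)%N].
      rewrite tE; move/colP/(_ (enum_rank ([ffun i => inord (J i)] : U))): Ay.
      rewrite !mxE => E; rewrite -[RHS]E; apply: eq_bigr => j _.
      rewrite !mxE enum_rankK /e; congr (_@_ _ * _); apply: eq_bigr => i _.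
      by rewrite ffunE inordK // ltnS.
    rewrite (bigD1 i) //= pw_gt ?mul0r ?raddf0 // ltnNge; exact: ni.
  apply/rowP => i; rewrite (ord1 i) [RHS]mxE mxE.
  transitivity (mcomb t g); last exact: van.
  by rewrite (tE g); apply: eq_bigr => j _; rewrite mxE.
move=> /submxP[D BD].
pose f : {mpoly F[k * d]} := \sum_i D 0 i *: mesyms F (enum_val i : U).
have fbox : f \is symle a by apply: rpred_sum => i _; apply/rpredZ/mesyms_symle.
exists (MkLambda fbox); apply/val_inj => /=; apply/mpolyP => m.
have bk : box (k * a) (@kfold_subst F d k f).
  by have /symle_box[] := kfold_subst_symle fbox.
have [/forallP lem|/forallPn[i ni]] := boolP [forall i : 'I_d, (m i <= k * a)%N]; last first.
  by rewrite (bk m i) ?(bg m i) // ltnNge.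
have mE : m = mon (enum_val (enum_rank ([ffun i => inord (m i)] : T))).
  by apply/mnmP => i; rewrite enum_rankK mnmE ffunE inordK // ltnS.
rewrite [in RHS]mE; move/rowP/(_ (enum_rank ([ffun i => inord (m i)] : T))): BD.
rewrite [LHS]mxE => ->; rewrite mxE kfold_comb (raddf_sum (mcoeff m)) /=.
by apply: eq_bigr => i _; rewrite mxE -mE mcoeffZ kfold_mesyms.
Qed.

(** The functional mcomb t vanishes on symmetric polynomials with exponents at
    most k d; on the symmetrized monomials this says that the symmetrization of t
    is 0, and the products of elementary symmetric polynomials only see this
    symmetrization. *)
Lemma kfold_injective : (a <= d)%N -> injective (kfold_map F a d k).
Proof.
move=> ad; suff K (f : {mpoly F[k * d]}) : f \is symle a -> @kfold_subst F d k f = 0 -> f = 0.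
  move=> [f fs] [g gs] /(congr1 val) /= E; apply: val_inj => /=; apply/eqP; rewrite -subr_eq0.
  apply/eqP/K; first exact: rpredB.
  by rewrite /kfold_subst raddfB /=; apply/eqP; rewrite subr_eq0; apply/eqP.
move=> fs kf0; have [t ft] := symle_spanned fs.
pose U := {ffun 'I_a -> 'I_(k * d).+1}.
have van g : g \is symmetric -> box (k * d) g -> mcomb t g = 0.
  move=> sg bg; apply: (@vanish_box F a d k (mcomb t : {scalar _})) => // m /=.
  have := congr1 (mcoeff [multinom m l | l < d]) kf0.
  rewrite mcoeff0 ft kfold_comb (raddf_sum (mcoeff _)) /= => E; rewrite -[RHS]E.
  apply: eq_bigr => J _; rewrite mcoeffZ kfold_mesyms; congr (_ * _).
  rewrite (eq_bigr (fun i => (pw F d k)`_(mon J i))) => [|i _]; last by rewrite mnmE.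
  rewrite prod_pw_duality; congr (_@_ _).
  by apply: eq_bigr => l _; rewrite mnmE.
pose act (s : 'S_a) (J : U) : U := [ffun i => J (s i)].
have actK s : cancel (act s) (act s^-1%g).
  by move=> J; apply/ffunP => i; rewrite !ffunE permKV.
have msym_mon s J : msym s 'X_[mon (act s J)] = 'X_[mon J] :> {mpoly F[a]}.
  by rewrite msymX; congr 'X_[_]; apply/mnmP => i; rewrite !mnmE ffunE permKV.
have mcombX J : mcomb t 'X_[mon J] = t J.
  rewrite /mcomb (bigD1 J) //= mcoeffX eqxx mulr1 big1 ?addr0 // => J' ne.
  by rewrite mcoeffX (inj_eq (@mon_inj _ _)) eq_sym (negPf ne) mulr0.
have t0 J : \sum_(s : 'S_a) t (act s J) = 0.
  have := van (symz F (mon J)) (symz_sym _ _).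
  rewrite /symz (raddf_sum (mcomb t)) /= => E; rewrite -[RHS]E.
    rewrite (reindex_inj invg_inj) /=; apply: eq_bigr => s _.
    by rewrite -(mcombX (act _ J)) -{2}(actK s^-1%g J) invgK msym_mon.
  elim/big_ind: _ => [||s _]; [exact: box0 | exact: boxD |].
  rewrite -(actK s^-1%g J) invgK msym_mon; apply: boxX => l.
  by rewrite mnmE -ltnS.
have mesyms_act s J : mesyms F (act s J) = mesyms F J.
  rewrite /mesyms [RHS](reindex_inj (@perm_inj _ s)) /=.
  by apply: eq_bigr => i _; rewrite ffunE.
have : f *+ a`! = 0.
  rewrite -card_Sn -sumr_const {1}ft.
  transitivity (\sum_(s : 'S_a) \sum_J t (act s J) *: mesyms F J).
    apply: eq_bigr => s _; rewrite (reindex_inj (can_inj (actK s))) /=.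
    by apply: eq_bigr => J _; rewrite mesyms_act.
  by rewrite exchange_big big1 // => J _; rewrite -scaler_suml t0 scale0r.
move/eqP; rewrite -scaler_nat scaler_eq0 pnatr_eq0 => /orP[|/eqP //].
by rewrite eqn0Ngt fact_gt0.
Qed.

End Main.


Theorem corollary1p3 (R : realType) (a d k : nat) :
  ((a <= d)%N -> injective (kfold_map R[i] a d k)) /\
  ((d <= a)%N ->
     forall g : Lambda R[i] (k * a) d,
       exists f : Lambda R[i] a (k * d), kfold_map R[i] a d k f = g).
Proof.
split; first exact: kfold_injective.
exact: kfold_surjective.
Qed.
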